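(* Let $k$ be a field and let $\Lambda \subseteq \mathbb{N}^d$ and $\Gamma \subseteq \mathbb{N}^e$ be two homogeneous affine semigroups. Assume that the semigroup rings $k[\Lambda]$ and $k[\Gamma]$ are Koszul. Let $g$ be a grading of $k[\Gamma]$, i.e. a semigroup map $g:\Gamma\to\mathbb{N}$ with $g(\gamma)>0$ for all $\gamma\ne 0$. Then the weighted Segre product $k[\Lambda]\circ_g k[\Gamma]$ with respect to $g$ is Koszul.
   Context: $\mathbb{N}=\{0,1,2,\ldots\}$. An affine semigroup $\Lambda\subseteq\mathbb{N}^d$ is a finitely generated additive sub-semigroup containing $0$; it is assumed that the elements of $\Lambda$ span $\mathbb{R}^d$ as a vector space (and likewise $\Gamma$ spans $\mathbb{R}^e$). The semigroup ring $k[\Lambda]$ is the subalgebra of $k[x_1,\ldots,x_d]$ generated by all monomials $x_1^{\lambda_1}\cdots x_d^{\lambda_d}$ with $(\lambda_1,\ldots,\lambda_d)\in\Lambda$. $\Lambda$ is homogeneous if all elements of a minimal generating set of $\Lambda$ lie on an affine hyperplane; then $k[\Lambda]$ is a standard graded $k$-algebra with respect to the standard grading, i.e. the semigroup map $\Lambda\to\mathbb{N}$ taking the value $1$ on the minimal generators. A $k$-algebra $A$ is standard graded if $A=\bigoplus_{i\in\mathbb{N}}A_i$ as a $k$-vector space, $A_0=k$, $A_iA_j\subseteq A_{i+j}$, and $A$ is generated as an algebra by $A_1$. A standard graded $k$-algebra $A$ is Koszul if $k$ has a linear resolution over $A$, equivalently $\operatorname{Tor}_i^A(k,k)_j=0$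 for all $i\ne j$. Weighted Segre product: let $f$ be the standard grading of $\Lambda$ and $h$ the standard grading of $\Gamma$. Let $\Lambda\circ_g\Gamma\subseteq\mathbb{N}^{d+e}$ be the affine semigroup of all pairs $(\lambda,\gamma)\in\Lambda\times\Gamma$ with $f(\lambda)=g(\gamma)$. Then $k[\Lambda]\circ_g k[\Gamma]$ is the semigroup ring $k[\Lambda\circ_g\Gamma]$ (the subalgebra of $k[\Lambda]\otimes_k k[\Gamma]$ generated by the elements $a\otimes b$ with $a$ homogeneous of standard degree $i$ and $b$ homogeneous of $g$-degree $i$, for some $i\in\mathbb{N}$), graded by $(\lambda,\gamma)\mapsto h(\gamma)$. *)

(* Defs.v *)
From HB Require Import structures.
From mathcomp Require Import all_boot all_order all_algebra.
From mathcomp Require Import classical_sets reals.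
From mathcomp Require Import mpoly.

Set Implicit Arguments.
Unset Strict Implicit.
Unset Printing Implicit Defensive.

Import GRing.Theory.
Local Open Scope classical_set_scope.
Local Open Scope ring_scope.

(** * Graded and Koszul algebras

    A k-algebra is a subalgebra [A : set S] of an ambient k-algebra [S], with
    homogeneous components [A_ : nat -> set S]. *)

Definition subalgebra (k : fieldType) (S : comAlgType k) (A : set S) : Prop :=
  GRing.subalg_closed (mem A).

Definition subalgebra_gen (k : fieldType) (S : comAlgType k) (G : set S) :
  set S := smallest (@subalgebra k S) G.

Record standard_graded (k : fieldType) (S : comAlgType k)
    (A : set S) (A_ : nat -> set S) : Prop := StandardGraded {
  sg_subalgebra : subalgebra A;
  sg_subspace : forall i, GRing.submod_closed (mem (A_ i));
  sg_sub : forall i, A_ i `<=` A;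
  sg_sum : forall a, A a -> exists n (c : nat -> S),
    (forall i, A_ i (c i)) /\ a = \sum_(i < n) c i;
  sg_direct : forall n (c : nat -> S), (forall i, A_ i (c i)) ->
    \sum_(i < n) c i = 0 -> forall i, (i < n)%N -> c i = 0;
  sg_deg0 : A_ 0%N = range (fun c : k => c%:A : S);
  sg_mul : forall i j a b, A_ i a -> A_ j b -> A_ (i + j)%N (a * b);
  sg_gen : A = subalgebra_gen (A_ 1%N)
}.

(* The ideal A_1 + A_2 + ... of A, so that k = A / A_+ as a graded module. *)
Definition irrelevant_ideal (k : fieldType) (S : comAlgType k)
    (A_ : nat -> set S) : set S :=
  [set a | exists n (c : nat -> S),
     (forall i, A_ i.+1 (c i)) /\ a = \sum_(i < n) c i].

Definition mx_over (S : Type) (A : set S) m n (M : 'M[S]_(m, n)) : Prop :=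
  forall p q, A (M p q).

(* A linear resolution of k over A is an exact complex of graded A-modules
     ... -> A(-2)^(b 2) -> A(-1)^(b 1) -> A^(b 0) -> k -> 0
   with maps of degree 0.  Elements of A^(b i) are row vectors with entries
   in A and [D i] acts by right multiplication; having degree 0 as a map
   A(-i-1)^(b i.+1) -> A(-i)^(b i) means that the entries of [D i] lie in A_1.
   The augmentation sends v to the class of [v *m eps] in A / A_+ = k, with
   [eps] over A_0 = k.  The ranks are finite, as is automatic when A_1 is
   finite-dimensional (such a resolution is minimal, and A is noetherian). *)
Record linear_resolution (k : fieldType) (S : comAlgType k)
    (A : set S) (A_ : nat -> set S) (b : nat -> nat)
    (D : forall i, 'M[S]_(b i.+1, b i)) (eps : 'cV[S]_(b 0%N)) : Prop :=
  LinearResolution {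
  lr_linear : forall i, mx_over (A_ 1%N) (D i);
  lr_aug : mx_over (A_ 0%N) eps;
  lr_surjective : exists2 v : 'rV[S]_(b 0%N), mx_over A v &
    irrelevant_ideal A_ ((v *m eps) 0 0 - 1);
  lr_exact_aug : forall v : 'rV[S]_(b 0%N), mx_over A v ->
    (irrelevant_ideal A_ ((v *m eps) 0 0) <->
     exists2 w : 'rV[S]_(b 1%N), mx_over A w & v = w *m D 0%N);
  lr_exact : forall i (v : 'rV[S]_(b i.+1)), mx_over A v ->
    (v *m D i = 0 <->
     exists2 w : 'rV[S]_(b i.+2), mx_over A w & v = w *m D i.+1)
}.

Definition koszul (k : fieldType) (S : comAlgType k)
    (A : set S) (A_ : nat -> set S) : Prop :=
  standard_graded A A_ /\
  exists (b : nat -> nat) (D : forall i, 'M[S]_(b i.+1, b i))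
    (eps : 'cV[S]_(b 0%N)), linear_resolution A A_ D eps.

(** * Affine semigroups

    N^d is the type ['X_{1..d}] of exponent vectors of monomials. *)

Definition subsemigroup d (L : set 'X_{1..d}) : Prop :=
  L 0%MM /\ forall m1 m2, L m1 -> L m2 -> L (m1 + m2)%MM.

Definition subsemigroup_gen d (G : set 'X_{1..d}) : set 'X_{1..d} :=
  smallest (@subsemigroup d) G.

Definition affine_semigroup d (L : set 'X_{1..d}) : Prop :=
  exists s : seq 'X_{1..d}, L = subsemigroup_gen [set` s].

Definition minimal_generating_set d (L G : set 'X_{1..d}) : Prop :=
  L = subsemigroup_gen G /\
  forall G' : set 'X_{1..d}, G' `<=` G -> L = subsemigroup_gen G' -> G' = G.

Definition mnm_vec (R : realType) d (m : 'X_{1..d}) : 'rV[R]_d :=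
  \row_j (m j)%:R.

Definition spanning (R : realType) d (L : set 'X_{1..d}) : Prop :=
  exists2 s : seq 'X_{1..d}, [set` s] `<=` L &
    <<[seq mnm_vec R m | m <- s]>>%VS = fullv.
Arguments spanning R {d} L.

(* The hyperplane is {x | <x, w> = c}.  The case w = 0, c != 0 (the empty set)
   is kept only so that the semigroup {0} in N^0, whose minimal generating set
   is empty, counts as homogeneous. *)
Definition homogeneous (R : realType) d (L : set 'X_{1..d}) : Prop :=
  exists2 G : set 'X_{1..d}, minimal_generating_set L G &
  exists (w : 'cV[R]_d) (c : R), ((w != 0) || (c != 0)) /\
    forall m, G m -> (mnm_vec R m *m w) 0 0 = c.
Arguments homogeneous R {d} L.

(* Semigroup maps L -> N are total functions, of which only the values on L
   are relevant. *)
Definition semigroup_map d (L : set 'X_{1..d}) (f : 'X_{1..d} -> nat) : Prop :=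
  forall m1 m2, L m1 -> L m2 -> f (m1 + m2)%MM = (f m1 + f m2)%N.

Definition grading d (L : set 'X_{1..d}) (g : 'X_{1..d} -> nat) : Prop :=
  semigroup_map L g /\ forall m, L m -> m <> 0%MM -> (0 < g m)%N.

Definition standard_grading d (L : set 'X_{1..d}) (f : 'X_{1..d} -> nat) :
    Prop :=
  semigroup_map L f /\
  forall G, minimal_generating_set L G -> forall m, G m -> f m = 1%N.

(** * Semigroup rings and weighted Segre products *)

Definition semigroup_ring (k : fieldType) d (L : set 'X_{1..d}) :
    set {mpoly k[d]} :=
  subalgebra_gen [set 'X_[m] | m in L].
Arguments semigroup_ring k {d} L _.

Definition semigroup_ring_deg (k : fieldType) d (L : set 'X_{1..d})
    (f : 'X_{1..d} -> nat) (i : nat) : set {mpoly k[d]} :=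
  [set p | semigroup_ring k L p /\ forall m, m \in msupp p -> f m = i].
Arguments semigroup_ring_deg k {d} L f i _.

(* The two components of a vector in N^(d + e) = N^d x N^e. *)
Definition mnm_fst d e (m : 'X_{1..d + e}) : 'X_{1..d} :=
  [multinom m (lshift e i) | i < d].

Definition mnm_snd d e (m : 'X_{1..d + e}) : 'X_{1..e} :=
  [multinom m (rshift d i) | i < e].

Definition weighted_segre d e (L : set 'X_{1..d}) (f : 'X_{1..d} -> nat)
    (G : set 'X_{1..e}) (g : 'X_{1..e} -> nat) : set 'X_{1..d + e} :=
  [set m | [/\ L (mnm_fst m), G (mnm_snd m) & f (mnm_fst m) = g (mnm_snd m)]].

(* Main.v *)
Require Import Defs.
From HB Require Import structures.
From mathcomp Require Import all_boot all_order all_algebra.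
From mathcomp Require Import boolp classical_sets reals.
From mathcomp Require Import mpoly zify.

(** The Koszul property of a semigroup ring can be read off the multigraded
    modules over it.  Since a semigroup is cancellative, a multigraded
    submodule of a free module is a family of subspaces [M x] of one space
    [k^p], increasing for the divisibility order; no ring is left, only a poset.
    In this language the ring of [S] is Koszul iff the strict up-set [S \ 0] has
    a free resolution whose l-th generators have degree at most [l + 1]
    ([fine_koszul]).

    Let [C] be the weighted Segre product.  For [b] in [Lambda], [c] in [Gamma]
    and fixed [s], [t], consider the C-module spanned by the pairs
    [(lambda, gamma)] with [b | lambda], [c | gamma] and
    [f lambda + s = g gamma + t].  Let [e = (f b + s) - (g c + t)].
    - If [e = 0], this module is free, generated by [(b, c)].
    - If [e < 0], no element has [lambda = b].  So the module is the pullback,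
      along [(lambda, gamma) |-> lambda - b], of the up-set [Lambda \ 0].
      Pulling back is exact, hence the linear resolution of [Lambda \ 0] becomes
      a resolution by modules of the same kind with [b] replaced by [b + x].
    - If [e > 0], the same works with [gamma - c] and the up-set [Gamma \ 0].
    By induction on the number of steps, and then on [|e|], the l-th syzygies of
    this module are generated in degree at most [h c + max(e, 0) + l]
    ([resolves_shifted]).  Finally the up-set [C \ 0] is itself a pullback of
    [Gamma \ 0] along the second projection, and the free modules in the
    resolution of [Gamma \ 0] pull back to modules with [e <= 0]; so [C \ 0] has a
    linear resolution ([resolves_weighted_segre]).

    The homological algebra required is elementary and is carried out with
    partial resolutions: extensions ([resolves_ext]), quotients
    ([resolves_quot]) and the independence of the choice of generators
    ([resolves_syzygies]).  It is done for linear categories, which cover both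
    graded modules over a polynomial subring and families over a poset.  The
    given linear resolution need not be multigraded; independence of the choice
    of generators allows the generators to be replaced by their multigraded
    components, one step at a time ([resolves_of_coarse]).  Conversely, minimal
    multigraded generators assemble into matrices of linear forms
    ([resolves_linear_resolution]). *)

Set Implicit Arguments.
Unset Strict Implicit.
Unset Printing Implicit Defensive.

Import GRing.Theory.
Local Open Scope classical_set_scope.
Local Open Scope ring_scope.

(** * Partial free resolutions of graded modules *)

Section Resolutions.

Variables (R : nzRingType) (X : Type) (hom : X -> X -> set R).

(** The set [hom x y] of scalars carries degree [x] into degree [y].  For modules
    over a graded ring it is the component of degree [y - x]; for families of
    subspaces over a poset it is the whole field if [x <= y], and 0 otherwise. *)
Record linear_category : Prop := LinearCategory {
  lcat0 : forall x y, hom x y 0;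
  lcatB : forall x y a c, hom x y a -> hom x y c -> hom x y (a - c);
  lcat1 : forall x, hom x x 1;
  lcatM : forall x y z a c, hom x y a -> hom y z c -> hom x z (c * a)
}.

Record submod p (M : X -> set 'rV[R]_p) : Prop := Submod {
  submod0 : forall x, M x 0;
  submodD : forall x u v, M x u -> M x v -> M x (u + v);
  submodZ : forall x y a v, hom x y a -> M x v -> M y (a *: v)
}.

Definition zero_mod p (x : X) : set 'rV[R]_p := [set 0].
Arguments zero_mod p x _ : clear implicits.

Definition free_mod q (b : 'I_q -> X) (x : X) : set 'rV[R]_q :=
  [set v | forall i, hom (b i) x (v 0 i)].

Definition syzygies q p (b : 'I_q -> X) (G : 'M[R]_(q, p))
    (K : X -> set 'rV[R]_p) (x : X) : set 'rV[R]_q :=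
  [set v | free_mod b x v /\ K x (v *m G)].

Record generates p (M K : X -> set 'rV[R]_p) (D : X -> Prop)
    q (b : 'I_q -> X) (G : 'M[R]_(q, p)) : Prop := Generates {
  gen_deg : forall i, D (b i);
  gen_mem : forall i, M (b i) (row i G);
  gen_span : forall x m, M x m ->
    exists2 v, free_mod b x v & K x (m - v *m G)
}.

(** First [n] steps of a resolution of the quotient M/K by finitely generated free
    modules, the l-th generators having their degrees in [D l].  Quotients are
    kept as pairs of submodules of a row space: then every syzygy module is
    again a submodule of a row space, and all maps are matrices. *)
Fixpoint resolves n (D : nat -> X -> Prop) p (M K : X -> set 'rV[R]_p) : Prop :=
  if n is n'.+1 then
    exists q (b : 'I_q -> X) (G : 'M[R]_(q, p)),
      generates M K (D 0%N) b G /\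
      resolves n' (fun l => D l.+1) (syzygies b G K) (@zero_mod q)
  else True.

Hypothesis Hcat : linear_category.

Let HN x y a : hom x y a -> hom x y (- a).
Proof. by move=> Ha; rewrite -[- a]add0r; apply: lcatB => //; exact: lcat0. Qed.

Let HD x y a c : hom x y a -> hom x y c -> hom x y (a + c).
Proof. by move=> Ha Hc; rewrite -[c]opprK; apply: lcatB => //; exact: HN. Qed.

Lemma submodN p (M : X -> set 'rV[R]_p) x v : submod M -> M x v -> M x (- v).
Proof.
by move=> HM Mv; rewrite -scaleN1r; apply: (submodZ HM) Mv; apply: HN; exact: lcat1.
Qed.

Lemma submodB p (M : X -> set 'rV[R]_p) x u v :
  submod M -> M x u -> M x v -> M x (u - v).
Proof. by move=> HM Mu Mv; apply: submodD => //; exact: submodN. Qed.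

Lemma submod_comb p q (M : X -> set 'rV[R]_p) (b : 'I_q -> X) (G : 'M[R]_(q, p))
    x v :
  submod M -> (forall i, M (b i) (row i G)) -> free_mod b x v -> M x (v *m G).
Proof.
move=> HM MG Hv; rewrite mulmx_sum_row; elim/big_ind: _ => //.
- exact: submod0.
- by move=> *; exact: submodD.
- by move=> i _; apply: (submodZ HM) (MG i); exact: Hv.
Qed.

Lemma zero_submod p : submod (@zero_mod p).
Proof.
split=> [//|x u v -> ->|x y a v _ ->]; first by rewrite /zero_mod /= addr0.
by rewrite /zero_mod /= scaler0.
Qed.

Lemma free_submod q (b : 'I_q -> X) : submod (free_mod b).
Proof.
split=> [x i|x u v Hu Hv i|x y a v Ha Hv i]; rewrite !mxE.
- exact: lcat0.
- exact: HD.
- exact: (lcatM Hcat (Hv i) Ha).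
Qed.

Lemma syzygies_submod q p (b : 'I_q -> X) (G : 'M[R]_(q, p)) K :
  submod K -> submod (syzygies b G K).
Proof.
move=> HK; have HF := free_submod b.
split=> [x|x u v [Hu Ku] [Hv Kv]|x y a v Ha [Hv Kv]]; split.
- exact: (submod0 HF).
- by rewrite mul0mx; exact: submod0.
- exact: (submodD HF Hu Hv).
- by rewrite mulmxDl; exact: submodD.
- exact: (submodZ HF) Hv.
- by rewrite -scalemxAl; exact: (submodZ HK) Kv.
Qed.

Lemma resolves_mono n (D E : nat -> X -> Prop) p (M K M' K' : X -> set 'rV[R]_p) :
  (forall l x, D l x -> E l x) ->
  (forall x v, M x v <-> M' x v) -> (forall x v, K x v <-> K' x v) ->
  resolves n D M K -> resolves n E M' K'.
Proof.
elim: n D E p M K M' K' => [//|n IHn] D E p M K M' K' DE MM KK.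
move=> [q [b [G [[bD MG GM] syzR]]]]; exists q, b, G; split.
  split=> [i|i|x m /MM /GM[v Hv Kv]]; [exact/DE|exact/MM|].
  by exists v => //; apply/KK.
apply: IHn syzR => [l x|x v|//]; first exact: DE.
by split=> -[Hv Kv]; split=> //; apply/KK.
Qed.

(** A matrix inducing an isomorphism M/K = M'/K' transports generators both ways,
    and the transported generators have literally the same syzygies. *)
Lemma resolves_iso n D p p' (M K : X -> set 'rV[R]_p) (M' K' : X -> set 'rV[R]_p')
    (phi : 'M[R]_(p, p')) :
  submod M -> submod M' -> submod K' ->
  (forall x v, M x v -> M' x (v *m phi)) ->
  (forall x v, M' x v -> exists2 u, M x u & K' x (v - u *m phi)) ->
  (forall x v, M x v -> (K x v <-> K' x (v *m phi))) ->
  resolves n D M K <-> resolves n D M' K'.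
Proof.
move=> HM HM' HK' phiM phi_surj phi_ker.
case: n => [//|n]; split=> -[q [b [G [[bD MG GM] syzR]]]].
  exists q, b, (G *m phi); split.
    split=> // [i|x m' M'm'].
      by rewrite row_mul; exact: phiM.
    have [m Mm Km] := phi_surj _ _ M'm'; have [v Hv Kv] := GM _ _ Mm.
    exists v => //; rewrite mulmxA.
    have -> : m' - v *m G *m phi = (m' - m *m phi) + (m - v *m G) *m phi.
      by rewrite mulmxBl addrA subrK.
    apply: submodD => //; apply/phi_ker => //.
    by apply: submodB => //; exact: (submod_comb HM).
  apply: resolves_mono syzR => // x v; rewrite /syzygies /= mulmxA.
  by split=> -[Hv Kv]; split=> //; apply/phi_ker => //; exact: (submod_comb HM).
have /choice[u Hu] : forall i, exists u, M (b i) u /\ K' (b i) (row i G - u *m phi).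
  by move=> i; have [u Mu Ku] := phi_surj _ _ (MG i); exists u.
pose G' : 'M_(q, p) := \matrix_i u i.
have MG' i : M (b i) (row i G') by rewrite rowK; case: (Hu i).
have KG x v : free_mod b x v -> K' x (v *m (G - G' *m phi)).
  apply: submod_comb => // i; rewrite linearB /= row_mul rowK.
  by case: (Hu i).
have syzE x v : free_mod b x v -> K x (v *m G') <-> K' x (v *m G).
  move=> Hv; rewrite phi_ker; last exact: (submod_comb HM).
  have -> : v *m G = v *m G' *m phi + v *m (G - G' *m phi).
    by rewrite mulmxBr mulmxA [X in _ + X]addrC addNKr.
  split=> [|KvG]; first by move=> ?; apply: submodD => //; exact: KG.
  by rewrite -[v *m G' *m phi](addrK (v *m (G - G' *m phi))); apply: submodB => //; exact: KG.
exists q, b, G'; split.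
  split=> // x m Mm; have [v Hv Kv] := GM _ _ (phiM _ _ Mm).
  exists v => //; apply/phi_ker.
    by apply: submodB => //; exact: (submod_comb HM).
  rewrite mulmxBl.
  have -> : m *m phi - v *m G' *m phi = (m *m phi - v *m G) + v *m (G - G' *m phi).
    by rewrite mulmxBr mulmxA addrA subrK.
  by apply: submodD => //; exact: KG.
by apply: resolves_mono syzR => // x v; split=> -[Hv Kv]; split=> //; apply/syzE.
Qed.

Lemma resolves_image n D p p' (M K : X -> set 'rV[R]_p) (M' K' : X -> set 'rV[R]_p')
    (phi : 'M[R]_(p, p')) :
  submod M -> submod M' -> submod K' ->
  (forall x v, M x v -> M' x (v *m phi)) ->
  (forall x v, M' x v -> exists2 u, M x u & K' x (v - u *m phi)) ->
  (forall x v, M x v -> (K x v <-> K' x (v *m phi))) ->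
  resolves n D M K -> resolves n D M' K'.
Proof. by move=> h1 h2 h3 h4 h5 h6; case: (resolves_iso n D h1 h2 h3 h4 h5 h6). Qed.

Lemma resolves_lift n D p p' (M K : X -> set 'rV[R]_p) (M' K' : X -> set 'rV[R]_p')
    (phi : 'M[R]_(p, p')) :
  submod M -> submod M' -> submod K' ->
  (forall x v, M x v -> M' x (v *m phi)) ->
  (forall x v, M' x v -> exists2 u, M x u & K' x (v - u *m phi)) ->
  (forall x v, M x v -> (K x v <-> K' x (v *m phi))) ->
  resolves n D M' K' -> resolves n D M K.
Proof. by move=> h1 h2 h3 h4 h5 h6; case: (resolves_iso n D h1 h2 h3 h4 h5 h6). Qed.

Lemma resolves_trivial n D p (M K : X -> set 'rV[R]_p) :
  (forall x v, M x v -> K x v) -> resolves n D M K.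
Proof.
elim: n D p M K => [//|n IHn] D p M K MK.
have b : 'I_0 -> X by case.
exists 0%N, b, 0; split.
  split=> [[]|[]|x m Mm] //; exists 0; first by case.
  by rewrite mul0mx subr0; exact: MK.
by apply: IHn => x v _; apply/rowP; case.
Qed.

Lemma resolves_free n D q (b : 'I_q -> X) :
  (forall i, D 0%N (b i)) -> resolves n D (free_mod b) (@zero_mod q).
Proof.
case: n => [//|n] bD; exists q, b, 1%:M; split.
  split=> // [i j|x m Hm].
    rewrite !mxE; case: eqP => [<-|_]; [exact: lcat1 | exact: lcat0].
  by exists m => //; rewrite mulmx1 subrr.
by apply: resolves_trivial => x v [_]; rewrite mulmx1.
Qed.

Definition split_deg q q' (b : 'I_q -> X) (b' : 'I_q' -> X) (i : 'I_(q + q')) : X :=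
  match split i with inl j => b j | inr j => b' j end.

Lemma free_split q q' (b : 'I_q -> X) (b' : 'I_q' -> X) x v v' :
  free_mod (split_deg b b') x (row_mx v v') <-> free_mod b x v /\ free_mod b' x v'.
Proof.
split=> [Hv|[Hv Hv'] i].
  split=> i.
    by have := Hv (lshift _ i); rewrite row_mxEl /split_deg -/(unsplit (inl i)) unsplitK.
  by have := Hv (rshift _ i); rewrite row_mxEr /split_deg -/(unsplit (inr i)) unsplitK.
by rewrite mxE /split_deg; case: split.
Qed.

Lemma generates_split p q q' (M : X -> set 'rV[R]_p) (b : 'I_q -> X) (b' : 'I_q' -> X) G G' :
  (forall i, M (b i) (row i G)) -> (forall i, M (b' i) (row i G')) ->
  forall i, M (split_deg b b' i) (row i (col_mx G G')).
Proof.
move=> MG MG' i; rewrite /split_deg; case: splitP => j ij.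
  have -> : i = lshift _ j by exact: val_inj.
  by rewrite rowKu.
have -> : i = rshift _ j by exact: val_inj.
by rewrite rowKd.
Qed.

Definition first_part q q' (M : X -> set 'rV[R]_(q + q')) x : set 'rV[R]_(q + q') :=
  [set w | M x w /\ rsubmx w = 0].

Lemma first_part_submod q q' (M : X -> set 'rV[R]_(q + q')) :
  submod M -> submod (first_part M).
Proof.
move=> HM; split=> [x|x u v [Mu u0] [Mv v0]|x y a v Ha [Mv v0]]; split.
- exact: submod0.
- by rewrite linear0.
- exact: submodD.
- by rewrite linearD /= u0 v0 addr0.
- exact: submodZ Mv.
- by rewrite linearZ /= v0 scaler0.
Qed.

(** Relations between the generators of an extension that only involve the
    generators of the submodule are the syzygies of the latter. *)
Lemma syz_first n D p q q' (K : X -> set 'rV[R]_p) (b : 'I_q -> X) (b' : 'I_q' -> X) G G' :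
  submod K ->
  resolves n D (syzygies b G K) (@zero_mod q) ->
  resolves n D (first_part (syzygies (split_deg b b') (col_mx G G') K)) (@zero_mod _).
Proof.
move=> HK; have HS := syzygies_submod b G HK.
have HS' := syzygies_submod (split_deg b b') (col_mx G G') HK.
apply: (resolves_image (phi := row_mx 1%:M 0)) => //.
- exact: first_part_submod.
- exact: zero_submod.
- move=> x v [Hv Kv]; rewrite mul_mx_row mulmx1 mulmx0; split; last by rewrite row_mxKr.
  split; last by rewrite mul_row_col mul0mx addr0.
  by apply/free_split; split=> //; exact: (submod0 (free_submod b')).
- move=> x w [[]]; rewrite -{1 2}(hsubmxK w) => /free_split[Hv _].
  rewrite mul_row_col => Kv w0; exists (lsubmx w).
    by split=> //; move: Kv; rewrite w0 mul0mx addr0.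
  by rewrite mul_mx_row mulmx1 mulmx0 -w0 hsubmxK /zero_mod /= subrr.
- move=> x v _; rewrite mul_mx_row mulmx1 mulmx0; split=> [->|]; first by rewrite row_mx0.
  by rewrite /zero_mod /= -[X in _ = X]row_mx0 => /eq_row_mx[].
Qed.

(** Horseshoe lemma: the generators of K/L and lifted generators of M/K generate
    M/L, and their syzygies are an extension of the two syzygy modules. *)
Lemma resolves_ext n D p (M K L : X -> set 'rV[R]_p) :
  submod M -> submod K -> submod L ->
  (forall x v, L x v -> K x v) -> (forall x v, K x v -> M x v) ->
  resolves n D K L -> resolves n D M K -> resolves n D M L.
Proof.
elim: n D p M K L => [//|n IHn] D p M K L HM HK HL LK KM.
move=> [q [b [G [[bD KG GK] syzR]]]] [q' [b' [G' [[bD' MG' GM'] syzR']]]].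
exists (q + q')%N, (split_deg b b'), (col_mx G G'); split.
  split=> [i||x m Mm]; first by rewrite /split_deg; case: split.
    by apply: generates_split => // i; exact: KM.
  have [v' Hv' Kv'] := GM' _ _ Mm; have [v Hv Kv] := GK _ _ Kv'.
  exists (row_mx v v'); first exact/free_split.
  by rewrite mul_row_col [v *m G + _]addrC opprD addrA.
have HS := syzygies_submod (split_deg b b') (col_mx G G') HL.
apply: (IHn _ _ _ (first_part (syzygies (split_deg b b') (col_mx G G') L))) => //.
- exact: first_part_submod.
- exact: zero_submod.
- by move=> x v ->; split; [exact: (submod0 HS)|rewrite linear0].
- by move=> x v [].
- exact: syz_first.
have HS' := syzygies_submod b' G' HK.
apply: (resolves_lift (phi := col_mx 0 1%:M)) syzR'.
- exact: HS.
- exact: HS'.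
- exact: zero_submod.
- move=> x w []; rewrite -(hsubmxK w) => /free_split[Hv Hv'].
  rewrite !mul_row_col mulmx0 mulmx1 add0r => Lw; split=> //.
  rewrite -[_ *m G'](addKr (lsubmx w *m G)) addrC.
  by apply: submodB => //; [exact: LK|exact: (submod_comb HK)].
- move=> x v' [Hv' Kv']; have [v Hv Lv] := GK _ _ Kv'.
  exists (row_mx (- v) v'); last by rewrite mul_row_col mulmx0 mulmx1 add0r /zero_mod /= subrr.
  split; last by rewrite mul_row_col mulNmx addrC.
  by apply/free_split; split=> //; exact: (submodN (free_submod b)).
- move=> x w Sw; rewrite -{2}(hsubmxK w) mul_row_col mulmx0 mulmx1 add0r.
  by split=> [[]|].
Qed.

(** Generators of M/L also generate M/K; their syzygies modulo K are an extension
    of K/L by their syzygies modulo L.  This is the mapping cone of K/L -> M/L, and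
    explains why K/L is needed for one step less, with the bounds moved up by one. *)
Lemma resolves_quot n D p (M K L : X -> set 'rV[R]_p) :
  submod M -> submod K -> submod L ->
  (forall x v, L x v -> K x v) -> (forall x v, K x v -> M x v) ->
  resolves n.-1 (fun l => D l.+1) K L -> resolves n D M L -> resolves n D M K.
Proof.
case: n => [//|n] HM HK HL LK KM KR [q [b [G [[bD MG GM] syzR]]]].
exists q, b, G; split.
  split=> // x m /GM[v Hv Lv]; exists v => //; exact: LK.
have HSK := syzygies_submod b G HK; have HSL := syzygies_submod b G HL.
apply: (resolves_ext (K := syzygies b G L)) => //.
- exact: zero_submod.
- by move=> x v ->; exact: (submod0 HSL).
- by move=> x v [Hv Lv]; split=> //; exact: LK.
apply: (resolves_lift (phi := G)) KR.
- exact: HSK.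
- exact: HK.
- exact: HL.
- by move=> x v [].
- move=> x v Kv; have [u Hu Lu] := GM _ _ (KM _ _ Kv); exists u => //; split=> //.
  by rewrite -[u *m G](subKr v); apply: submodB => //; exact: LK.
- by move=> x v [Hv Kv]; split=> [[]|].
Qed.

Lemma free_trans q q' (b : 'I_q -> X) (b' : 'I_q' -> X) (P : 'M[R]_(q, q')) x v :
  (forall i, free_mod b' (b i) (row i P)) -> free_mod b x v -> free_mod b' x (v *m P).
Proof. by move=> HP Hv; apply: submod_comb Hv => //; exact: free_submod. Qed.

(** Independence of the choice of generators (Schanuel).  The syzygies S of the
    union of two generating families are an extension of a free module by either
    of the two syzygy modules, and this extension splits.  So S inherits a
    resolution from one of them and passes it on to the other. *)
Lemma resolves_syzygies n (D : nat -> X -> Prop) p q (M K : X -> set 'rV[R]_p)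
    (b : 'I_q -> X) G :
  (forall l x, D l x -> D l.+1 x) ->
  submod M -> submod K -> (forall x v, K x v -> M x v) ->
  generates M K (D 0%N) b G -> resolves n.+1 D M K ->
  resolves n (fun l => D l.+1) (syzygies b G K) (@zero_mod q).
Proof.
move=> Dmono HM HK KM [bD MG GM] [q' [b' [G' [[bD' MG' GM'] syzR]]]].
have HS := syzygies_submod b G HK.
pose S := syzygies (split_deg b' b) (col_mx G' G) K.
have HSS : submod S := syzygies_submod _ _ HK.
have SR : resolves n (fun l => D l.+1) S (@zero_mod _).
  apply: (resolves_ext (K := first_part S)) => //.
  - exact: first_part_submod.
  - exact: zero_submod.
  - by move=> x v ->; split; [exact: (submod0 HSS)|rewrite linear0].
  - by move=> x v [].
  - exact: syz_first.
  have FR : resolves n (fun l => D l.+1) (free_mod b) (@zero_mod q).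
    by apply: resolves_free => i; exact: Dmono.
  apply: (resolves_lift (phi := col_mx 0 1%:M)) FR.
  - exact: HSS.
  - exact: free_submod.
  - exact: zero_submod.
  - move=> x w []; rewrite -(hsubmxK w) => /free_split[Hv Hv'] _.
    by rewrite mul_row_col mulmx0 mulmx1 add0r.
  - move=> x v Hv; have [u Hu Ku] := GM' _ _ (submod_comb HM MG Hv).
    exists (row_mx (- u) v); last by rewrite mul_row_col mulmx0 mulmx1 add0r /zero_mod /= subrr.
    split; last by rewrite mul_row_col mulNmx addrC.
    by apply/free_split; split=> //; exact: (submodN (free_submod b')).
  - move=> x w Sw; rewrite -{2}(hsubmxK w) mul_row_col mulmx0 mulmx1 add0r.
    by split=> [[]|].
have /choice[h Hh] : forall i, exists h,
    free_mod b (b' i) h /\ K (b' i) (row i G' - h *m G).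
  by move=> i; have [h ? ?] := GM _ _ (MG' i); exists h.
pose P : 'M_(q', q) := \matrix_i h i.
have HP i : free_mod b (b' i) (row i P) by rewrite rowK; case: (Hh i).
have KP x v : free_mod b' x v -> K x (v *m (G' - P *m G)).
  apply: submod_comb => // i; rewrite linearB /= row_mul rowK.
  by case: (Hh i).
(* The relations expressing the rows of [G'] through those of [G] form a free
   submodule [T], and [S / T] is the module of syzygies of [G]. *)
pose T x := [set w | S x w /\ lsubmx w *m P + rsubmx w = 0].
have HT : submod T.
  split=> [x|x u v [Su u0] [Sv v0]|x y a v Ha [Sv v0]]; split.
  - exact: submod0.
  - by rewrite !linear0 mul0mx addr0.
  - exact: submodD.
  - by rewrite !linearD /= mulmxDl addrACA u0 v0 addr0.
  - exact: submodZ Sv.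
  - by rewrite !linearZ /= -scalemxAl -scalerDr v0 scaler0.
apply: (resolves_image (M := S) (K := T) (phi := col_mx P 1%:M)) => //.
- exact: zero_submod.
- move=> x w []; rewrite -(hsubmxK w) => /free_split[Hv Hv'].
  rewrite !mul_row_col mulmx1 => Kw; split.
    by apply: submodD Hv'; [exact: free_submod|exact: free_trans Hv].
  have -> : (lsubmx w *m P + rsubmx w) *m G =
      lsubmx w *m G' + rsubmx w *m G - lsubmx w *m (G' - P *m G).
    by rewrite mulmxDl mulmxBr mulmxA opprB [X in _ = X]addrC addrA subrK.
  by apply: submodB => //; exact: KP.
- move=> x v [Hv Kv]; exists (row_mx 0 v).
    split; last by rewrite mul_row_col mul0mx add0r.
    by apply/free_split; split=> //; exact: (submod0 (free_submod b')).
  by rewrite mul_row_col mul0mx add0r mulmx1 /zero_mod /= subrr.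
- move=> x w Sw; rewrite -{2}(hsubmxK w) mul_row_col mulmx1.
  by split=> [[]|].
apply: (resolves_quot (L := @zero_mod _)) SR => //.
- exact: zero_submod.
- by move=> x v ->; exact: submod0.
- by move=> x v [].
have FR : resolves n.-1 (fun l => D l.+2) (free_mod b') (@zero_mod q').
  by apply: resolves_free => i; apply/Dmono/Dmono/bD'.
apply: (resolves_image (phi := row_mx 1%:M (- P))) FR.
- exact: free_submod.
- exact: HT.
- exact: zero_submod.
- move=> x v Hv; rewrite mul_mx_row mulmx1 mulmxN; split.
    split; last by rewrite mul_row_col mulNmx -mulmxA -mulmxBr; exact: KP.
    apply/free_split; split=> //; apply: (submodN (free_submod b)).
    exact: free_trans Hv.
  by rewrite row_mxKl row_mxKr subrr.
- move=> x w [[]]; rewrite -{1 2}(hsubmxK w) => /free_split[Hv _] _ w0.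
  exists (lsubmx w) => //; rewrite mul_mx_row mulmx1 mulmxN.
  have -> : - (lsubmx w *m P) = rsubmx w by apply/eqP; rewrite eq_sym -addr_eq0 addrC w0.
  by rewrite hsubmxK /zero_mod /= subrr.
- move=> x v _; rewrite mul_mx_row mulmx1 mulmxN; split=> [->|].
    by rewrite mul0mx oppr0 row_mx0.
  by rewrite /zero_mod /= -[X in _ = X]row_mx0 => /eq_row_mx[].
Qed.

(** Filter the direct sum by the submodules of vectors supported on the first [j]
    coordinates. *)
Lemma resolves_sum n D q (N : 'I_q -> X -> set 'rV[R]_1) :
  (forall i, submod (N i)) ->
  (forall i, resolves n D (N i) (@zero_mod 1)) ->
  resolves n D (fun x => [set v : 'rV_q | forall i, N i x (col i v)]) (@zero_mod q).
Proof.
move=> NS NR.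
pose F j x := [set v : 'rV_q | forall i, N i x (col i v) /\ ((j <= i)%N -> v 0 i = 0)].
have HF j : submod (F j).
  split=> [x i|x u v Fu Fv i|x y a v Ha Fv i]; split.
  - by rewrite linear0; exact: (submod0 (NS i)).
  - by rewrite mxE.
  - rewrite linearD /=; apply: (submodD (NS i)); [exact: (Fu i).1|exact: (Fv i).1].
  - by move=> ji; rewrite mxE (Fu i).2 // (Fv i).2 // addr0.
  - rewrite linearZ /=; exact: (submodZ (NS i) Ha (Fv i).1).
  - by move=> ji; rewrite mxE (Fv i).2 // mulr0.
suff FR j : (j <= q)%N -> resolves n D (F j) (@zero_mod q).
  apply: resolves_mono (FR q (leqnn q)) => // x v; split=> [Fv i|Nv i]; first exact: (Fv i).1.
  by split=> //; rewrite leqNgt ltn_ord.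
elim: j => [_|j IHj jq].
  apply: resolves_trivial => x v Fv; apply/rowP => i; rewrite mxE.
  exact: (Fv i).2.
pose j' := Ordinal jq.
apply: (resolves_ext (K := F j)) => //.
- exact: zero_submod.
- by move=> x v ->; exact: submod0.
- by move=> x v Fv i; split; [exact: (Fv i).1|move=> /ltnW; exact: (Fv i).2].
- exact/IHj/ltnW.
have colE (v : 'rV_q) : v *m delta_mx j' 0 = col j' v :> 'rV_1 by rewrite colE.
apply: (resolves_lift (phi := delta_mx j' 0)) (NR j').
- exact: HF.
- exact: NS.
- exact: zero_submod.
- by move=> x v Fv; rewrite colE; exact: (Fv j').1.
- move=> x v Nv; exists (v *m delta_mx 0 j'); last first.
    have -> : v *m delta_mx 0 j' *m delta_mx j' 0 = v.
      rewrite -mulmxA mul_delta_mx -[RHS]mulmx1; congr (v *m _).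
      by apply/matrixP => a c; rewrite !mxE !ord1.
    by rewrite /zero_mod /= subrr.
  have vE i : col i (v *m delta_mx 0 j') = if i == j' then v else 0.
    apply/matrixP => a c; rewrite !mxE big_ord1 !mxE !ord1 eqxx /=.
    by case: eqP => _; rewrite ?mulr1 ?mulr0 // mxE.
  move=> i; rewrite vE; split; first by case: eqP => [->|_] //; exact: (submod0 (NS i)).
  move=> ji; have /colP/(_ 0) := vE i; rewrite mxE => ->.
  by case: eqP ji => [->|_]; rewrite ?ltnn // mxE.
- move=> x v Fv; rewrite colE; split=> [Fjv|/rowP/(_ 0)].
    by apply/rowP => i; rewrite !mxE (Fjv j').2.
  rewrite !mxE => v0 i; split; first exact: (Fv i).1.
  rewrite leq_eqVlt => /orP[/eqP ji|]; last exact: (Fv i).2.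
  by have -> : i = j' by exact: val_inj.
Qed.

End Resolutions.

Arguments zero_mod {R X} p x _.

(** * Modules over a poset and weighted Segre products *)

Section Posets.

Variable k : fieldType.

Definition order_hom (X : Type) (le : X -> X -> Prop) (x y : X) : set k :=
  [set a | a = 0 \/ le x y].

Lemma order_category X (le : X -> X -> Prop) :
  (forall x, le x x) -> (forall x y z, le x y -> le y z -> le x z) ->
  linear_category (order_hom le).
Proof.
move=> le_refl le_trans; split=> [x y|x y a c|x|x y z a c].
- by left.
- by move=> [->|lexy] [->|lexy']; [left; rewrite subr0|right..].
- by right.
- move=> [->|lexy] [->|leyz]; try by left; rewrite ?mulr0 ?mul0r.
  by right; exact: le_trans leyz.
Qed.

Definition indicator X (U : X -> Prop) (x : X) : set 'rV[k]_1 :=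
  [set v | v = 0 \/ U x].

Lemma indicator_submod X (le : X -> X -> Prop) (U : X -> Prop) :
  (forall x y, le x y -> U x -> U y) -> submod (order_hom le) (indicator U).
Proof.
move=> Uup; split=> [x|x u v|x y a v]; first by left.
  by move=> [->|Ux] [->|Ux']; [left; rewrite addr0|right..].
by move=> [->|lexy] [->|Ux]; [left; rewrite ?scaler0 ?scale0r ..|right; exact: Uup Ux].
Qed.

(** Families on [X] become families on [Y] along a map [phi] that is monotone
    on the up-set [U], with value 0 outside [U]. *)
Definition pullback X Y (phi : Y -> X) (U : Y -> Prop) p
    (M : X -> set 'rV[k]_p) (y : Y) : set 'rV[k]_p :=
  [set v | (v = 0 \/ U y) /\ M (phi y) v].

Section Pullback.

Variables (X Y : Type) (leX : X -> X -> Prop) (leY : Y -> Y -> Prop).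
Variables (phi : Y -> X) (U : Y -> Prop).
Hypothesis leX_refl : forall x, leX x x.
Hypothesis leX_trans : forall x y z, leX x y -> leX y z -> leX x z.
Hypothesis leY_refl : forall y, leY y y.
Hypothesis leY_trans : forall x y z, leY x y -> leY y z -> leY x z.
Hypothesis phi_mono : forall y y', leY y y' -> U y -> U y' /\ leX (phi y) (phi y').

Let catX := order_category leX_refl leX_trans.
Let catY := order_category leY_refl leY_trans.

Lemma pullback_submod p (M : X -> set 'rV[k]_p) :
  submod (order_hom leX) M -> submod (order_hom leY) (pullback phi U M).
Proof.
move=> HM; split=> [x|x u v [U0 Mu] [V0 Mv]|x y a v].
- by split; [left|exact: (submod0 HM)].
- split; last exact: (submodD HM).
  by case: U0 V0 => [->|Ux] [->|Ux']; [left; rewrite addr0|right..].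
- move=> [->|lexy] [[->|Ux] Mv].
  + by rewrite scale0r; split; [left|exact: (submod0 HM)].
  + by rewrite scale0r; split; [left|exact: (submod0 HM)].
  + by rewrite scaler0; split; [left|exact: (submod0 HM)].
  + have [Uy lephi] := phi_mono lexy Ux.
    by split; [right|apply: (submodZ HM) Mv; right].
Qed.

(** The pullback is defined pointwise, so it is exact.  It turns a resolution by
    free modules into one by pullbacks of free modules; these need not be free,
    and it suffices that the l-th of them be resolved [n - l] steps. *)
Lemma resolves_pullback n (D : nat -> X -> Prop) (E : nat -> Y -> Prop) p
    (M : X -> set 'rV[k]_p) :
  submod (order_hom leX) M ->
  resolves (order_hom leX) n D M (zero_mod p) ->
  (forall m x, (m < n)%N -> D m x ->
    resolves (order_hom leY) (n - m) (fun l => E (m + l)%N)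
      (pullback phi U (indicator (leX x))) (zero_mod 1)) ->
  resolves (order_hom leY) n E (pullback phi U M) (zero_mod p).
Proof.
elim: n D E p M => [//|n IHn] D E p M HM [q [b [G [[bD MG GM] syzR]]]] DE.
have H0 := zero_submod (order_hom leX) p.
have HS : submod (order_hom leX) (syzygies (order_hom leX) b G (zero_mod p)).
  by apply: syzygies_submod.
have HF : submod (order_hom leX) (free_mod (order_hom leX) b) by apply: free_submod.
have SR : resolves (order_hom leY) n (fun l => E l.+1)
    (pullback phi U (syzygies (order_hom leX) b G (zero_mod p))) (zero_mod q).
  apply: IHn syzR _ => // m x mn Dx.
  by have := DE m.+1 x mn Dx; rewrite subSS.
have FR : resolves (order_hom leY) n.+1 E
    (pullback phi U (free_mod (order_hom leX) b)) (zero_mod q).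
  pose N i := pullback phi U (indicator (leX (b i))).
  have NS i : submod (order_hom leY) (N i).
    apply/pullback_submod/indicator_submod => x y lexy lebx.
    exact: leX_trans lexy.
  have NR i : resolves (order_hom leY) n.+1 E (N i) (zero_mod 1).
    by have := DE 0%N (b i) isT (bD i); rewrite subn0.
  have colE (v : 'rV[k]_q) i : col i v = 0 <-> v 0 i = 0.
    split=> [/colP/(_ 0)|v0]; first by rewrite !mxE.
    by apply/colP => j; rewrite !mxE ord1.
  apply: resolves_mono (resolves_sum catY NS NR) => // y v; split=> [Nv|[vU Fv] i].
    split=> [|i].
      have [Uy|nUy] := pselect (U y); first by right.
      by left; apply/rowP => i; rewrite mxE; apply/colE; case: (Nv i) => -[].
    by case: (Nv i) => _ [/colE ->|]; [left|right].
  split; first by case: vU => [->|]; [left; rewrite col0|right].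
  by case: (Fv i) => [/colE ->|]; [left|right].
apply: (resolves_image catY (phi := G)
  (M := pullback phi U (free_mod (order_hom leX) b))
  (K := pullback phi U (syzygies (order_hom leX) b G (zero_mod p)))).
- exact: pullback_submod.
- exact: pullback_submod.
- exact: zero_submod.
- move=> y v [vU Fv]; split; last exact: (submod_comb HM).
  by case: vU => [->|]; [left; rewrite mul0mx|right].
- move=> y m [mU Mm]; have [v Fv mE] := GM _ _ Mm.
  case: mU => [m0|Uy].
    exists 0; first by split; [left|exact: (submod0 HF)].
    by rewrite mul0mx subr0.
  by exists v => //; split=> //; right.
- move=> y v [vU Fv]; split=> [[_ []]|] //.
apply: (resolves_quot catY (L := zero_mod q)) FR => //.
- exact: pullback_submod.
- exact: pullback_submod.
- exact: zero_submod.
- by move=> y v ->; split; [left|exact: (submod0 HS)].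
- by move=> y v [vU [Fv _]].
Qed.

End Pullback.

Definition divides d (S : set 'X_{1..d}) (x y : 'X_{1..d}) : Prop :=
  exists2 z, S z & y = (x + z)%MM.

(** Multiplication by a monomial identifies the multidegrees of the semigroup ring
    with one copy of [k]; only the divisibility order remains. *)
Definition fine_hom d (S : set 'X_{1..d}) := order_hom (divides S).

Lemma divides_refl d (S : set 'X_{1..d}) : subsemigroup S -> forall x, divides S x x.
Proof. by case=> S0 _ x; exists 0%MM => //; rewrite addm0. Qed.

Lemma divides_trans d (S : set 'X_{1..d}) : subsemigroup S ->
  forall x y z, divides S x y -> divides S y z -> divides S x z.
Proof.
move=> [_ SD] x _ _ [u Su ->] [v Sv ->]; exists (u + v)%MM; first exact: SD.
by rewrite addmA.
Qed.

Lemma fine_category d (S : set 'X_{1..d}) :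
  subsemigroup S -> linear_category (fine_hom S).
Proof.
by move=> HS; apply: order_category; [exact: divides_refl|exact: divides_trans].
Qed.

Lemma nonzero_up d (S : set 'X_{1..d}) : subsemigroup S ->
  forall x y, divides S x y -> S x /\ x <> 0%MM -> S y /\ y <> 0%MM.
Proof.
move=> [_ SD] x _ [z Sz ->] [Sx x0]; split; first exact: SD.
by move=> /eqP; rewrite mnmD_eq0 => /andP[/eqP].
Qed.

Lemma nonzero_submod d (S : set 'X_{1..d}) : subsemigroup S ->
  submod (fine_hom S) (indicator (fun x => S x /\ x <> 0%MM)).
Proof. by move=> S_sub; apply: indicator_submod; exact: nonzero_up. Qed.

(** The Koszul property in multigraded form: the maximal monomial ideal has a
    linear resolution, up to any number of steps. *)
Definition fine_koszul d (S : set 'X_{1..d}) (f : 'X_{1..d} -> nat) : Prop :=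
  forall n, resolves (fine_hom S) n
    (fun l x => [/\ S x, x <> 0%MM & (f x <= l.+1)%N])
    (indicator (fun x => S x /\ x <> 0%MM)) (zero_mod 1).

Section Pairs.

Variables d e : nat.

Lemma mnm_fst0 : mnm_fst (0%MM : 'X_{1..d + e}) = 0%MM :> 'X_{1..d}.
Proof. by apply/mnmP => i; rewrite !mnmE. Qed.
Lemma mnm_snd0 : mnm_snd (0%MM : 'X_{1..d + e}) = 0%MM :> 'X_{1..e}.
Proof. by apply/mnmP => i; rewrite !mnmE. Qed.
Lemma mnm_fstD (x y : 'X_{1..d + e}) : mnm_fst (x + y)%MM = (mnm_fst x + mnm_fst y)%MM.
Proof. by apply/mnmP => i; rewrite !mnmE. Qed.
Lemma mnm_sndD (x y : 'X_{1..d + e}) : mnm_snd (x + y)%MM = (mnm_snd x + mnm_snd y)%MM.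
Proof. by apply/mnmP => i; rewrite !mnmE. Qed.

Definition mnm_pair (x : 'X_{1..d}) (y : 'X_{1..e}) : 'X_{1..d + e} :=
  [multinom match split i with inl j => x j | inr j => y j end | i < d + e].

Lemma mnm_fst_pair x y : mnm_fst (mnm_pair x y) = x.
Proof. by apply/mnmP => i; rewrite !mnmE -/(unsplit (inl i)) unsplitK. Qed.
Lemma mnm_snd_pair x y : mnm_snd (mnm_pair x y) = y.
Proof. by apply/mnmP => i; rewrite !mnmE -/(unsplit (inr i)) unsplitK. Qed.
Lemma mnm_pairK z : mnm_pair (mnm_fst z) (mnm_snd z) = z.
Proof.
apply/mnmP => i; rewrite mnmE; case: splitP => j ij; rewrite mnmE.
  by congr (z _); apply: val_inj.
by congr (z _); apply: val_inj.
Qed.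

End Pairs.

Lemma map0 n (S : set 'X_{1..n}) (c : 'X_{1..n} -> nat) :
  subsemigroup S -> semigroup_map S c -> c 0%MM = 0%N.
Proof. by move=> [S0 _] cD; have := cD _ _ S0 S0; rewrite addm0; lia. Qed.

Section WeightedSegre.

Variables (d e : nat) (L : set 'X_{1..d}) (G : set 'X_{1..e}).
Variables (f : 'X_{1..d} -> nat) (g h : 'X_{1..e} -> nat).
Hypotheses (L_sub : subsemigroup L) (G_sub : subsemigroup G).
Hypotheses (f_grading : grading L f) (g_grading : grading G g) (h_map : semigroup_map G h).
Hypotheses (L_koszul : fine_koszul L f) (G_koszul : fine_koszul G h).

Let C := weighted_segre L f G g.

Lemma weighted_segre_subsemigroup : subsemigroup C.
Proof.
have [[L0 LD] [G0 GD]] := (L_sub, G_sub).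
have [[fD _] [gD _]] := (f_grading, g_grading).
split.
  by split; rewrite ?mnm_fst0 ?mnm_snd0 // (map0 L_sub fD) (map0 G_sub gD).
move=> x y [Lx Gx fgx] [Ly Gy fgy].
split; rewrite ?mnm_fstD ?mnm_sndD; [exact: LD|exact: GD|].
by rewrite fD // gD // fgx fgy.
Qed.

(** Up to a translation, the part of the tensor product of k[L] and k[G] on which
    the two gradings differ by a constant.  It is a module over the Segre product,
    and it is free if [(b, c)] itself lies in that part. *)
Definition shifted (b : 'X_{1..d}) (c : 'X_{1..e}) (s t : nat) (y : 'X_{1..d + e}) : Prop :=
  [/\ divides L b (mnm_fst y), divides G c (mnm_snd y) &
      (f (mnm_fst y) + s = g (mnm_snd y) + t)%N].

Lemma shifted_up b c s t x y : L b -> G c ->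
  divides C x y -> shifted b c s t x -> shifted b c s t y.
Proof.
have [[L0 LD] [G0 GD]] := (L_sub, G_sub).
have [[fD _] [gD _]] := (f_grading, g_grading).
move=> Lb Gc [z [Lz Gz fgz] ->] [[u Lu xu] [v Gv xv] fgx].
have Lx : L (mnm_fst x) by rewrite xu; exact: LD.
have Gx : G (mnm_snd x) by rewrite xv; exact: GD.
split; rewrite ?mnm_fstD ?mnm_sndD.
- by exists (u + mnm_fst z)%MM; [exact: LD|rewrite xu addmA].
- by exists (v + mnm_snd z)%MM; [exact: GD|rewrite xv addmA].
- by rewrite fD // gD //; lia.
Qed.

Let leC_refl := divides_refl weighted_segre_subsemigroup.
Let leC_trans := divides_trans weighted_segre_subsemigroup.

Definition h_bounded T l (y : 'X_{1..d + e}) : Prop := (h (mnm_snd y) <= T + l)%N.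

Lemma resolves_shifted0 n b c s t T : L b -> G c ->
  (f b + s = g c + t)%N -> (h c <= T)%N ->
  resolves (fine_hom C) n (h_bounded T) (indicator (shifted b c s t)) (zero_mod 1).
Proof.
have [[L0 LD] [G0 GD]] := (L_sub, G_sub).
have [[fD _] [gD _]] := (f_grading, g_grading).
move=> Lb Gc fg hc.
have := @resolves_free k _ (fine_hom C) (fine_category weighted_segre_subsemigroup)
  n (h_bounded T) 1 (fun=> mnm_pair b c).
move=> /(_ (fun=> _)); rewrite /h_bounded mnm_snd_pair addn0 => /(_ hc).
apply: resolves_mono => // y v.
have NE : shifted b c s t y <-> divides C (mnm_pair b c) y.
  split=> [[[u Lu yu] [w Gw yw] fgy]|[z [Lz Gz fgz] ->]].
    exists (mnm_pair u w).
      split; rewrite ?mnm_fst_pair ?mnm_snd_pair //.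
      by move: fgy; rewrite yu yw fD // gD //; lia.
    rewrite -[y]mnm_pairK yu yw; apply/mnmP => i; rewrite !mnmE.
    by case: splitP => j _; rewrite mnmE.
  split; rewrite ?mnm_fstD ?mnm_sndD ?mnm_fst_pair ?mnm_snd_pair.
  - by exists (mnm_fst z).
  - by exists (mnm_snd z).
  - by rewrite fD // gD //; lia.
split=> [/(_ 0)[v0|Cy]|[->|/NE Cy] i].
- by left; apply/rowP => i; rewrite ord1 v0 mxE.
- by right; apply/NE.
- by left; rewrite mxE.
- by right.
Qed.

Lemma divides_sub n (S : set 'X_{1..n}) x y z :
  divides S x y -> divides S z (y - x)%MM <-> divides S (x + z)%MM y.
Proof.
move=> [u Su ->]; have -> : (x + u - x)%MM = u by rewrite addmC addmK.
split=> -[v Sv]; first by move=> ->; exists v => //; rewrite addmA.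
by move/eqP; rewrite -addmA eqm_add2l => /eqP ->; exists v.
Qed.

Lemma divides_subr n (S : set 'X_{1..n}) x y :
  divides S x y -> S (y - x)%MM /\ y = (x + (y - x))%MM.
Proof. by move=> [u Su ->]; rewrite [(x + u)%MM]addmC addmK addmC. Qed.

(** When the first grading falls short at [(b, c)], no element of the module has
    first component [b]; so the module is pulled back from the strict multiples
    of [b]. *)
Lemma resolves_shiftedL n b c s t T : L b -> G c ->
  (f b + s < g c + t)%N ->
  (forall m x, (m < n)%N -> [/\ L x, x <> 0%MM & (f x <= m.+1)%N] ->
     resolves (fine_hom C) (n - m) (h_bounded (T + m))
       (indicator (shifted (b + x) c s t)) (zero_mod 1)) ->
  resolves (fine_hom C) n (h_bounded T) (indicator (shifted b c s t)) (zero_mod 1).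
Proof.
have [[L0 LD] [G0 GD]] := (L_sub, G_sub).
have [[fD fpos] [gD gpos]] := (f_grading, g_grading).
move=> Lb Gc fg IH.
pose phi (y : 'X_{1..d + e}) := (mnm_fst y - b)%MM.
have phi_mono y y' : divides C y y' -> shifted b c s t y ->
    shifted b c s t y' /\ divides L (phi y) (phi y').
  move=> yy' Ny; have Ny' := shifted_up Lb Gc yy' Ny.
  have [by' _ _] := Ny'; have [by_ _ _] := Ny; split=> //.
  apply/divides_sub => //; have [_ <-] := divides_subr by_.
  by have [z [Lz Gz _] ->] := yy'; exists (mnm_fst z); rewrite ?mnm_fstD.
have HL := nonzero_submod L_sub.
have PB := resolves_pullback (divides_refl L_sub) (divides_trans L_sub)
  leC_refl leC_trans phi_mono (E := h_bounded T) HL (L_koszul n).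
have NE x y v : L x ->
  pullback phi (shifted b c s t) (indicator (divides L x)) y v <->
  indicator (shifted (b + x)%MM c s t) y v.
  move=> Lx; split=> [[[v0|Ny] [v0'|xy]]|[->|Ny]]; try by left.
  - right; have [by_ cy fgy] := Ny; split=> //.
    exact/divides_sub.
  - by split; left.
  - have [[z Lz yz] cy fgy] := Ny.
    have by_ : divides L b (mnm_fst y) by exists (x + z)%MM; [exact: LD|rewrite addmA].
    split; right; first by split.
    by apply/divides_sub => //; exists z.
unshelve epose proof (PB _) as PBR.
  move=> m x mn [Lx x0 fx].
  apply: resolves_mono (IH m x mn (And3 Lx x0 fx)) => // [l y|y v].
    by rewrite /h_bounded addnA.
  by split=> /NE; apply.
apply: resolves_mono PBR => // y v.
split=> [[[->|Ny] _]|[->|Ny]]; [by left|by right|by split; left|].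
split; right => //; have [by_ [w Gw yw] fgy] := Ny.
have [Lyb yE] := divides_subr by_; split=> // yb0.
have yb : mnm_fst y = b by rewrite yE -/(phi y) yb0 addm0.
by move: fgy; rewrite yb yw gD //; lia.
Qed.

(** Symmetric to [resolves_shiftedL].  Here a generator [x] of step [m] raises the
    degree [h c] by up to [m + 1]; the spare unit is what the drop of the excess
    of [f b + s] over [g c + t] compensates in [resolves_shifted]. *)
Lemma resolves_shiftedR n b c s t T : L b -> G c ->
  (g c + t < f b + s)%N ->
  (forall m x, (m < n)%N -> [/\ G x, x <> 0%MM & (h x <= m.+1)%N] ->
     resolves (fine_hom C) (n - m) (h_bounded (T + m))
       (indicator (shifted b (c + x) s t)) (zero_mod 1)) ->
  resolves (fine_hom C) n (h_bounded T) (indicator (shifted b c s t)) (zero_mod 1).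
Proof.
have [[L0 LD] [G0 GD]] := (L_sub, G_sub).
have [[fD fpos] [gD gpos]] := (f_grading, g_grading).
move=> Lb Gc fg IH.
pose phi (y : 'X_{1..d + e}) := (mnm_snd y - c)%MM.
have phi_mono y y' : divides C y y' -> shifted b c s t y ->
    shifted b c s t y' /\ divides G (phi y) (phi y').
  move=> yy' Ny; have Ny' := shifted_up Lb Gc yy' Ny.
  have [_ cy' _] := Ny'; have [_ cy _] := Ny; split=> //.
  apply/divides_sub => //; have [_ <-] := divides_subr cy.
  by have [z [Lz Gz _] ->] := yy'; exists (mnm_snd z); rewrite ?mnm_sndD.
have HG := nonzero_submod G_sub.
have PB := resolves_pullback (divides_refl G_sub) (divides_trans G_sub)
  leC_refl leC_trans phi_mono (E := h_bounded T) HG (G_koszul n).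
have NE x y v : G x ->
  pullback phi (shifted b c s t) (indicator (divides G x)) y v <->
  indicator (shifted b (c + x)%MM s t) y v.
  move=> Gx; split=> [[[v0|Ny] [v0'|xy]]|[->|Ny]]; try by left.
  - right; have [by_ cy fgy] := Ny; split=> //.
    exact/divides_sub.
  - by split; left.
  - have [by_ [z Gz yz] fgy] := Ny.
    have cy : divides G c (mnm_snd y) by exists (x + z)%MM; [exact: GD|rewrite addmA].
    split; right; first by split.
    by apply/divides_sub => //; exists z.
unshelve epose proof (PB _) as PBR.
  move=> m x mn [Gx x0 hx].
  apply: resolves_mono (IH m x mn (And3 Gx x0 hx)) => // [l y|y v].
    by rewrite /h_bounded addnA.
  by split=> /NE; apply.
apply: resolves_mono PBR => // y v.
split=> [[[->|Ny] _]|[->|Ny]]; [by left|by right|by split; left|].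
split; right => //; have [[w Lw yw] cy fgy] := Ny.
have [Gyc yE] := divides_subr cy; split=> // yc0.
have yc : mnm_snd y = c by rewrite yE -/(phi y) yc0 addm0.
by move: fgy; rewrite yc yw fD //; lia.
Qed.

(** Induction on [n], then on the defect [(f b + s) - (g c + t)].  The modules of
    the later steps are needed for fewer than [n] steps.  Those of the first step
    have a defect closer to 0: by exactly 1 if it is negative, while a positive
    defect may also jump below 0; hence the negative case comes first. *)
Lemma resolves_shifted n b c s t T : L b -> G c ->
  (h c + ((f b + s) - (g c + t)) <= T)%N ->
  resolves (fine_hom C) n (h_bounded T) (indicator (shifted b c s t)) (zero_mod 1).
Proof.
have [[L0 LD] [G0 GD]] := (L_sub, G_sub).
have [[fD fpos] [gD gpos]] := (f_grading, g_grading).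
elim/ltn_ind: n b c T => n IHn b c T.
have neg r b' c' T' : ((g c' + t) - (f b' + s) <= r)%N -> (f b' + s <= g c' + t)%N ->
    L b' -> G c' -> (h c' <= T')%N ->
    resolves (fine_hom C) n (h_bounded T') (indicator (shifted b' c' s t)) (zero_mod 1).
  elim: r b' c' T' => [|r IHr] b' c' T' er le Lb Gc hT.
    by apply: resolves_shifted0 => //; lia.
  have [eq0|lt0] := eqVneq (f b' + s)%N (g c' + t)%N.
    by apply: resolves_shifted0 => //; lia.
  apply: resolves_shiftedL => //; first lia.
  move=> [|m] x mn [Lx x0 fx].
    rewrite subn0 addn0; have := fpos _ Lx x0 => fx0.
    by apply: IHr; rewrite ?fD //; [lia|lia|exact: LD].
  by apply: IHn; [lia|exact: LD|by []|rewrite fD //; lia].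
have pos r b' c' T' : ((f b' + s) - (g c' + t) <= r)%N ->
    L b' -> G c' -> (h c' + ((f b' + s) - (g c' + t)) <= T')%N ->
    resolves (fine_hom C) n (h_bounded T') (indicator (shifted b' c' s t)) (zero_mod 1).
  elim: r b' c' T' => [|r IHr] b' c' T' er Lb Gc hT.
    by apply: (neg _ _ _ _ (leqnn _)) => //; lia.
  have [le|lt] := leqP (f b' + s)%N (g c' + t)%N.
    by apply: (neg _ _ _ _ (leqnn _)) => //; lia.
  apply: resolves_shiftedR => // m x mn [Gx x0 hx].
  have gx0 := gpos _ Gx x0.
  case: m mn hx => [|m] mn hx.
    rewrite subn0 addn0.
    by apply: IHr; [rewrite gD //; lia|by []|exact: GD|rewrite gD // h_map //; lia].
  by apply: IHn; [lia|by []|exact: GD|by rewrite gD // h_map //; lia].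
by move=> Lb Gc; exact: (pos _ _ _ _ (leqnn _)).
Qed.

(** The nonzero elements of the product are those with a nonzero second component,
    so they form the pullback of G \ 0; its free modules pull back to shifted
    modules with nonpositive defect, which are generated in the lowest degree. *)
Theorem resolves_weighted_segre n :
  resolves (fine_hom C) n (h_bounded 1)
    (indicator (fun y => C y /\ y <> 0%MM)) (zero_mod 1).
Proof.
have [[L0 LD] [G0 GD]] := (L_sub, G_sub).
have [[fD fpos] [gD gpos]] := (f_grading, g_grading).
have phi_mono y y' : divides C y y' -> C y ->
    C y' /\ divides G (mnm_snd y) (mnm_snd y').
  move=> [z Cz ->] Cy; split; first exact: (weighted_segre_subsemigroup.2).
  by exists (mnm_snd z); [case: Cz|exact: mnm_sndD].
have HG := nonzero_submod G_sub.
have PB := resolves_pullback (divides_refl G_sub) (divides_trans G_sub)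
  leC_refl leC_trans phi_mono (E := h_bounded 1) HG (G_koszul n).
have f0 := map0 L_sub fD; have g0 := map0 G_sub gD.
unshelve epose proof (PB _) as PBR.
  move=> m x mn [Gx x0 hx].
  have := @resolves_shifted (n - m) 0%MM x 0 0 (1 + m) L0 Gx.
  rewrite f0 add0n => /(_ ltac:(lia)); apply: resolves_mono => // y v.
  split=> [[->|[[u Lu yu] [w Gw yw] fgy]]|[[v0|[Ly Gy fgy]] [v0'|xy]]];
    try by [split; left|left].
    split; right; last by exists w.
    split; [by rewrite yu add0m|by rewrite yw; exact: GD|by move: fgy; rewrite !addn0].
  right; split=> //; last by rewrite !addn0.
  by exists (mnm_fst y) => //; rewrite add0m.
apply: resolves_mono PBR => // y v.
split=> [[[v0|[Ly Gy fgy]] [v0'|[_ y0]]]|[->|[[Ly Gy fgy] y0]]];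
  try by [left|split; left].
  by right; split=> // yy; apply: y0; rewrite yy mnm_snd0.
split; right => //; split=> // yy; apply: y0.
rewrite -[y]mnm_pairK yy; have -> : mnm_fst y = 0%MM.
  apply: contrapT => y1; have := fpos _ Ly y1.
  by rewrite fgy yy g0.
by apply/mnmP => i; rewrite mnmE; case: splitP => j _; rewrite !mnmE.
Qed.

End WeightedSegre.

End Posets.

(** * Polynomials with support in a semigroup *)

Section Polynomials.

Variables (k : fieldType) (d : nat).
Implicit Types (p q : {mpoly k[d]}) (m x : 'X_{1..d}).

Lemma mcoeffMXE p m x :
  (p * 'X_[m])@_x = if (m <= x)%MM then p@_(x - m) else 0.
Proof.
case: ifP => [mx|mx]; first by rewrite -{1}(submK mx) addmC mcoeffMX.
apply/eqP; rewrite mcoeff_eq0; apply/negP => /msuppM_le /allpairsP[[a c] /=].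
move=> [_]; rewrite msuppX inE => /eqP -> xE; move: mx.
by rewrite xE lem_addl.
Qed.

Lemma mpolyE_uniq p (s : seq 'X_{1..d}) : uniq s -> {subset msupp p <= s} ->
  p = \sum_(m <- s) p@_m *: 'X_[m].
Proof.
move=> us ps; rewrite {1}(mpolyE p) [RHS](bigID (mem (msupp p))) /=.
rewrite [X in _ + X]big1 ?addr0 => [|m /memN_msupp_eq0 ->]; last by rewrite scale0r.
rewrite -[RHS]big_filter; apply: perm_big; apply: uniq_perm.
- exact: msupp_uniq.
- exact: filter_uniq.
- by move=> m; rewrite mem_filter; case: (boolP (m \in msupp p)) => [/ps|].
Qed.

Definition mrestr (P : pred 'X_{1..d}) p : {mpoly k[d]} :=
  \sum_(m <- msupp p | P m) p@_m *: 'X_[m].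

Lemma mcoeff_restr P p x : (mrestr P p)@_x = if P x then p@_x else 0.
Proof.
rewrite /mrestr raddf_sum /= -big_filter.
rewrite (eq_bigr (fun m => p@_m * (m == x)%:R)); last by move=> m _; rewrite mcoeffZ mcoeffX.
have [xs|xs] := boolP (x \in [seq m <- msupp p | P m]).
  rewrite (bigD1_seq x) ?filter_uniq ?msupp_uniq //= eqxx mulr1 big1 ?addr0.
    by move: xs; rewrite mem_filter => /andP[->].
  by move=> m /negbTE ->; rewrite mulr0.
rewrite big_seq big1 => [|m ms]; last first.
  by case: eqP ms xs => [->->|] //; rewrite mulr0.
by move: xs; rewrite mem_filter negb_and; case: (P x) => //= /memN_msupp_eq0.
Qed.

Definition mdivX m p : {mpoly k[d]} := \sum_(x <- msupp p) p@_x *: 'X_[x - m].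

Lemma mdivXK m p : (forall x, x \in msupp p -> (m <= x)%MM) -> mdivX m p * 'X_[m] = p.
Proof.
move=> pm; rewrite [RHS]mpolyE /mdivX mulr_suml; apply: eq_big_seq => x xp.
by rewrite -scalerAl -mpolyXD submK // pm.
Qed.

Lemma mulX_eq0 m p : (p * 'X_[m] == 0) = (p == 0).
Proof.
apply/eqP/eqP => [pX|->]; last by rewrite mul0r.
by apply/mpolyP => x; rewrite -(mcoeffMX p m) pX !mcoeff0.
Qed.

End Polynomials.

Section RowVectors.

Variables (k : fieldType) (d : nat).

Definition coefs n (x : 'X_{1..d}) (v : 'rV[{mpoly k[d]}]_n) : 'rV[k]_n :=
  \row_i (v 0 i)@_x.

Definition monom_row n (x : 'X_{1..d}) (v : 'rV[k]_n) : 'rV[{mpoly k[d]}]_n :=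
  \row_i (v 0 i *: 'X_[x]).

(** Coordinate [i] of a row over the ring has its origin at the degree [b i] of the
    [i]-th generator; multiplication by this matrix expresses all coordinates in
    absolute multidegrees. *)
Definition shift_mx n (b : 'I_n -> 'X_{1..d}) : 'M[{mpoly k[d]}]_n :=
  diag_mx (\row_i 'X_[b i]).

Definition monom_mx n p (b : 'I_n -> 'X_{1..d}) (G : 'M[k]_(n, p)) :
    'M[{mpoly k[d]}]_(n, p) := shift_mx b *m map_mx (@mpolyC d k) G.

Lemma coefsP n (u v : 'rV[{mpoly k[d]}]_n) :
  (forall x, coefs x u = coefs x v) -> u = v.
Proof.
move=> uv; apply/rowP => i; apply/mpolyP => x.
by have /rowP/(_ i) := uv x; rewrite !mxE.
Qed.

Lemma coefs0 n x : coefs x (0 : 'rV_n) = 0.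
Proof. by apply/rowP => i; rewrite !mxE mcoeff0. Qed.

Lemma coefsD n x (u v : 'rV_n) : coefs x (u + v) = coefs x u + coefs x v.
Proof. by apply/rowP => i; rewrite !mxE mcoeffD. Qed.

Lemma coefs_sum n x (I : Type) (r : seq I) (F : I -> 'rV_n) :
  coefs x (\sum_(i <- r) F i) = \sum_(i <- r) coefs x (F i).
Proof.
by elim: r => [|i r IHr]; rewrite ?big_nil ?coefs0 // !big_cons coefsD IHr.
Qed.

Lemma coefs_monom n x y (v : 'rV_n) : coefs x (monom_row y v) = if y == x then v else 0.
Proof.
apply/rowP => i; rewrite !mxE mcoeffZ mcoeffX.
by case: eqP => _; rewrite ?mulr1 ?mulr0 // mxE.
Qed.

Lemma coefs_mulC n p x (u : 'rV_n) (G : 'M[k]_(n, p)) :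
  coefs x (u *m map_mx (@mpolyC d k) G) = coefs x u *m G.
Proof.
apply/rowP => j; rewrite !mxE raddf_sum; apply: eq_bigr => i _ /=.
by rewrite !mxE mulrC mcoeffCM mulrC.
Qed.

Lemma mul_shift_mx n (w : 'rV_n) b i : (w *m shift_mx b) 0 i = w 0 i * 'X_[b i].
Proof. by rewrite mul_mx_diag !mxE. Qed.

Lemma coefs_monom_mx n p x (w : 'rV_n) b (G : 'M[k]_(n, p)) :
  coefs x (w *m monom_mx b G) = coefs x (w *m shift_mx b) *m G.
Proof. by rewrite mulmxA coefs_mulC. Qed.

Lemma row_monom_mx n p (b : 'I_n -> 'X_{1..d}) (G : 'M[k]_(n, p)) i :
  row i (monom_mx b G) = monom_row (b i) (row i G).
Proof.
apply/rowP => j; rewrite !mxE (bigD1 i) //= big1 ?addr0 => [|l /negbTE li].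
  by rewrite !mxE eqxx mulr1n mulrC mul_mpolyC.
by rewrite !mxE eq_sym li mulr0n mul0r.
Qed.

Definition row_supp n (v : 'rV[{mpoly k[d]}]_n) : seq 'X_{1..d} :=
  undup (flatten [seq msupp (v 0 i) | i <- enum 'I_n]).

Lemma row_suppP n (v : 'rV_n) x : reflect (coefs x v <> 0) (x \in row_supp v).
Proof.
rewrite mem_undup; apply: (iffP flatten_mapP) => [[i _ xi] v0|].
  by move: xi; rewrite mcoeff_msupp; have /rowP/(_ i) := v0; rewrite !mxE => ->; rewrite eqxx.
have [[i xi] _|nx []] := pselect (exists i, x \in msupp (v 0 i)).
  by exists i; rewrite // mem_enum.
apply/rowP => i; rewrite !mxE; apply: memN_msupp_eq0.
by apply/negP => xi; apply: nx; exists i.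
Qed.

Lemma coefs_row_supp n (v : 'rV_n) x : x \notin row_supp v -> coefs x v = 0.
Proof. by move=> xv; apply: contrapT => /row_suppP; exact/negP. Qed.

End RowVectors.

Section Coarsening.

Variables (k : fieldType) (d : nat) (L : set 'X_{1..d}) (f : 'X_{1..d} -> nat).
Hypotheses (L_sub : subsemigroup L) (f_map : semigroup_map L f).

(** Homogeneous elements of the semigroup ring of degree [j - i]; the additive form
    forces 0 when [j < i]. *)
Definition ring_hom (i j : nat) : set {mpoly k[d]} :=
  [set p | forall m, m \in msupp p -> L m /\ (f m + i = j)%N].

Lemma ring_category : linear_category ring_hom.
Proof.
have [L0 LD] := L_sub.
split=> [i j m|i j p q Hp Hq m|i m|i j l p q Hp Hq m].
- by rewrite msupp0.
- move/msuppB_le; rewrite mem_cat => /orP[]; [exact: Hp|exact: Hq].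
- by rewrite msupp1 inE => /eqP ->; split=> //; rewrite (map0 L_sub f_map).
- move/msuppM_le => /allpairsP[[u v] /= [/Hq[Lu <-] /Hp[Lv <-] ->]].
  by split; [exact: LD|rewrite f_map //; lia].
Qed.

(** The graded module over the polynomial subring whose multigraded components
    are the [M x]. *)
Definition coarse n (M : 'X_{1..d} -> set 'rV[k]_n) (j : nat) :
    set 'rV[{mpoly k[d]}]_n :=
  [set v | forall x, M x (coefs x v) /\ (coefs x v = 0 \/ f x = j)].

Definition supported_on n (U : 'X_{1..d} -> Prop) (M : 'X_{1..d} -> set 'rV[k]_n) :=
  forall x v, M x v -> v = 0 \/ U x.

Lemma coarse_monom n (M : 'X_{1..d} -> set 'rV[k]_n) x v :
  submod (fine_hom L) M -> M x v -> coarse M (f x) (monom_row x v).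
Proof.
move=> HM Mv y; rewrite coefs_monom; case: eqP => [<-|_].
  by split=> //; right.
by split; [exact: (submod0 HM)|left].
Qed.

Lemma coarse_submod n (M : 'X_{1..d} -> set 'rV[k]_n) :
  submod (fine_hom L) M -> supported_on L M -> submod ring_hom (coarse M).
Proof.
move=> HM ML; split=> [j x|j u v Mu Mv x|i j p v Hp Mv x].
- by rewrite coefs0; split; [exact: (submod0 HM)|left].
- rewrite coefsD; have [[Mxu Du] [Mxv Dv]] := (Mu x, Mv x).
  split; first exact: (submodD HM).
  case: Du => [->|->]; last by right.
  by rewrite add0r.
have -> : coefs x (p *: v) = \sum_(m <- msupp p)
    if (m <= x)%MM then p@_m *: coefs (x - m)%MM v else 0.
  apply/rowP => t; rewrite !mxE summxE {1}(mpolyE p) mulr_suml raddf_sum /=.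
  apply: eq_bigr => m _; rewrite -scalerAl mcoeffZ ['X_[m] * _]mulrC mcoeffMXE.
  by case: ifP => _; rewrite !mxE ?mulr0.
split.
  rewrite big_seq; elim/big_ind: _ => [||m mp]; first exact: (submod0 HM).
    exact: (submodD HM).
  case: ifP => [mx|_]; last exact: (submod0 HM).
  have [Lm _] := Hp m mp; have [Mm _] := Mv (x - m)%MM.
  by apply: (submodZ HM) Mm; right; exists m => //; rewrite submK.
have [fx|nfx] := eqVneq (f x) j; [by right|left].
rewrite big_seq big1 // => m mp; case: ifP => // mx.
have [Lm fm] := Hp m mp; have [Mm [->|fv]] := Mv (x - m)%MM; first by rewrite scaler0.
have [->|Lxm] := ML _ _ Mm; first by rewrite scaler0.
by move: nfx; rewrite -(submK mx) f_map // fv addnC fm eqxx.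
Qed.

(** The coefficient of each monomial is a combination of the generators; the
    finitely many combinations are collected into polynomials. *)
Lemma span_monom_mx n q (M : 'X_{1..d} -> set 'rV[k]_n) D (b : 'I_q -> 'X_{1..d})
    (G : 'M[k]_(q, n)) (u : 'rV[{mpoly k[d]}]_n) :
  generates (fine_hom L) M (zero_mod n) D b G ->
  (forall x, M x (coefs x u)) ->
  exists2 w : 'rV_q, u = w *m monom_mx b G &
    forall i m, m \in msupp (w 0 i) -> L m /\ coefs (m + b i)%MM u <> 0.
Proof.
move=> [_ _ GM] Mu.
have /choice[c Hc] : forall x, exists c, free_mod (fine_hom L) b x c /\ coefs x u = c *m G.
  by move=> x; have [c ? /eqP] := GM _ _ (Mu x); rewrite subr_eq0 => /eqP; exists c.
pose W := \sum_(x <- row_supp u) monom_row x (c x).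
have cW x : coefs x W = if x \in row_supp u then c x else 0.
  rewrite coefs_sum.
  rewrite (eq_bigr (fun y => if y == x then c x else 0)); last first.
    by move=> y _; rewrite coefs_monom; case: eqP => [->|].
  case: ifP => xv.
    by rewrite (bigD1_seq x) ?undup_uniq //= eqxx big1 ?addr0 // => y /negbTE ->.
  by rewrite big_seq big1 // => y yv; case: eqP yv xv => [->->|].
have WE i x : x \in msupp (W 0 i) -> x \in row_supp u /\ divides L (b i) x.
  rewrite mcoeff_msupp => /eqP Wx; have /rowP/(_ i) := cW x; rewrite mxE.
  case: ifP => [xu|_]; last by rewrite mxE.
  by move=> WcE; split=> //; case: (Hc x) => /(_ i)[c0|]; first by rewrite WcE c0 in Wx.
have WK : (\row_i mdivX (b i) (W 0 i)) *m shift_mx k b = W.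
  apply/rowP => i; rewrite mul_shift_mx mxE mdivXK // => x /WE[_ [z _ ->]].
  exact: lem_addr.
exists (\row_i mdivX (b i) (W 0 i)).
  rewrite mulmxA WK; apply: coefsP => x; rewrite coefs_mulC cW.
  case: ifP => [_|/negbT xu]; first by case: (Hc x).
  by rewrite mul0mx; exact: coefs_row_supp.
move=> i m; rewrite mcoeff_msupp mxE -(mcoeffMX _ (b i)) => mi.
have /WE[/row_suppP bu [z Lz]] : (b i + m)%MM \in msupp (W 0 i).
  by rewrite mcoeff_msupp -WK mul_shift_mx mxE.
by move/addmI => mz; split; [rewrite mz|rewrite addmC].
Qed.

Lemma coarse_generates n q (M : 'X_{1..d} -> set 'rV[k]_n) t (b : 'I_q -> 'X_{1..d})
    (G : 'M[k]_(q, n)) :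
  submod (fine_hom L) M -> (forall i, L (b i)) ->
  generates (fine_hom L) M (zero_mod n) (fun x => (f x <= t)%N) b G ->
  generates ring_hom (coarse M) (zero_mod n) (fun j => (j <= t)%N)
    (fun i => f (b i)) (monom_mx b G).
Proof.
move=> HM Lb genG; have [bD MG GM] := genG; split=> // [i|j u Mu].
  by rewrite row_monom_mx; exact: coarse_monom.
have [w uE wE] := span_monom_mx genG (fun x => (Mu x).1).
exists w; last by rewrite uE /zero_mod /= subrr.
move=> i m /wE[Lm mu]; split=> //; rewrite -f_map //.
by case: (Mu (m + b i)%MM) => _ [].
Qed.

(** Multiplying the [i]-th coordinate by the monomial [b i] identifies the syzygies
    over the polynomial subring with the coarsening of the syzygies over the
    poset. *)
Lemma coarse_syzygies n q t N (b : 'I_q -> 'X_{1..d}) (G : 'M[k]_(q, n)) :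
  (forall i, L (b i)) ->
  resolves ring_hom N t (syzygies ring_hom (fun i => f (b i)) (monom_mx b G) (zero_mod n))
    (zero_mod q) ->
  resolves ring_hom N t (coarse (syzygies (fine_hom L) b G (zero_mod n))) (zero_mod q).
Proof.
move=> Lb; have [L0 LD] := L_sub.
have catF := fine_category k L_sub; have catR := ring_category.
have HS : submod (fine_hom L) (syzygies (fine_hom L) b G (zero_mod n)).
  by apply: syzygies_submod => //; exact: zero_submod.
have SL : supported_on L (syzygies (fine_hom L) b G (zero_mod n)).
  move=> x v [Fv _]; have [Lx|nLx] := pselect (L x); [by right|left].
  apply/rowP => i; rewrite mxE; case: (Fv i) => // -[z Lz xE].
  by case: nLx; rewrite xE; exact: LD.
apply: (resolves_image catR (phi := shift_mx k b)).
- by apply: syzygies_submod => //; exact: zero_submod.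
- exact: coarse_submod.
- exact: zero_submod.
- move=> j w [Fw w0] x.
  have supp_w i : (w 0 i * 'X_[b i])@_x <> 0 -> divides L (b i) x /\ f x = j.
    move/eqP; rewrite -mcoeff_msupp => /msuppM_le /allpairsP[[u v] /= [uw]].
    rewrite msuppX inE => /eqP -> ->; have [Lu <-] := Fw i u uw.
    by split; [exists u => //; rewrite addmC|rewrite f_map].
  split; first split.
  + move=> i; have [w0i|/supp_w[bx _]] := pselect ((w 0 i * 'X_[b i])@_x = 0).
      by left; rewrite mxE mul_shift_mx.
    by right.
  + by rewrite /zero_mod /= -coefs_monom_mx w0 coefs0.
  have [fx|nfx] := eqVneq (f x) j; [by right|left].
  apply/rowP => i; rewrite mxE mul_shift_mx mxE; apply: contrapT.
  by move=> /supp_w[_ fx]; rewrite fx eqxx in nfx.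
- move=> j u Mu; pose w : 'rV_q := \row_i mdivX (b i) (u 0 i).
  have uL i x : x \in msupp (u 0 i) -> divides L (b i) x /\ f x = j.
    rewrite mcoeff_msupp => /eqP ui; have [[Fx _] fx] := Mu x.
    split; first by case: (Fx i) => //; rewrite mxE.
    by case: fx => // /rowP/(_ i); rewrite !mxE.
  have wu : w *m shift_mx k b = u.
    apply/rowP => i; rewrite mul_shift_mx mxE mdivXK // => x /uL[[z _ ->] _].
    exact: lem_addr.
  exists w; last by rewrite wu /zero_mod /= subrr.
  split.
    move=> i m; rewrite mcoeff_msupp -(mcoeffMX _ (b i)) -mul_shift_mx wu.
    rewrite -mcoeff_msupp => /uL[[z Lz]] /addmI -> fx; split=> //.
    by rewrite -f_map // addmC.
  by apply: coefsP => x; rewrite coefs_monom_mx wu coefs0; case: (Mu x) => [[_ ->]].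
- move=> j w _; rewrite /zero_mod /=; split=> [->|wX]; first by rewrite mul0mx.
  apply/rowP => i; rewrite mxE; apply/eqP; rewrite -(mulX_eq0 (b i)).
  by rewrite -mul_shift_mx wX mxE.
Qed.

End Coarsening.

Section Refining.

Variables (k : fieldType) (d : nat) (L : set 'X_{1..d}) (f : 'X_{1..d} -> nat).
Hypotheses (L_sub : subsemigroup L) (f_map : semigroup_map L f).

Lemma mcoeffM_uniq (p q : {mpoly k[d]}) (s : seq 'X_{1..d}) x :
  uniq s -> {subset msupp q <= s} ->
  (p * q)@_x = \sum_(m <- s) (if (m <= x)%MM then p@_(x - m) else 0) * q@_m.
Proof.
move=> us qs; rewrite {1}(mpolyE_uniq us qs) mulr_sumr raddf_sum /=.
by apply: eq_bigr => m _; rewrite -scalerAr mcoeffZ mcoeffMXE mulrC.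
Qed.

(** The multigraded components of homogeneous generators still generate, and by
    independence of the choice of generators their syzygies remain resolved;
    these syzygies are multigraded, so the argument can be repeated. *)
Lemma resolves_of_coarse (U : 'X_{1..d} -> Prop) n t p (M : 'X_{1..d} -> set 'rV[k]_p) :
  (forall x, U x -> L x) -> (forall x y, divides L x y -> U x -> U y) ->
  submod (fine_hom L) M -> supported_on U M ->
  resolves (ring_hom L f) n (fun l j => (j <= t + l)%N) (coarse f M) (zero_mod p) ->
  resolves (fine_hom L) n (fun l x => U x /\ (f x <= t + l)%N) M (zero_mod p).
Proof.
move=> UL Uup; have [L0 LD] := L_sub.
elim: n t p M => [//|n IHn] t p M HM MU RR.
have catF := fine_category k L_sub; have catR := ring_category k L_sub f_map.
have ML : supported_on L M by move=> x v /MU[->|/UL]; [left|right].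
have [q [b [G [[bD MG GM] _]]]] := RR.
(* The generators are the components [m] of the rows [i], where [m] runs over all
   monomials that occur and the degree of [m] is that of the row. *)
pose S := undup (flatten [seq row_supp (row i G) | i <- enum 'I_q]).
have GS i j : {subset msupp (G i j) <= S}.
  move=> m mG; rewrite mem_undup; apply/flatten_mapP; exists i; first by rewrite mem_enum.
  apply/row_suppP => /rowP/(_ j); rewrite !mxE => /eqP.
  by rewrite mcoeff_eq0 mG.
have uS : uniq S by exact: undup_uniq.
pose s := [seq im <- [seq (i, m) | i <- enum 'I_q, m <- S] | `[< U im.2 >] && (f im.2 == b im.1)].
pose c (r : 'I_(size s)) := tnth (in_tuple s) r.
pose b' r := (c r).2.
pose G' := \matrix_(r < size s) coefs (c r).2 (row (c r).1 G).
have cs r : U (c r).2 /\ f (c r).2 = b (c r).1.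
  have : c r \in s by exact: mem_tnth.
  by rewrite mem_filter => /andP[/andP[/asboolP Uc /eqP fc] _].
have sumE (V : zmodType) (F : 'I_q -> 'X_{1..d} -> V) :
    (forall i m, coefs m (row i G) = 0 -> F i m = 0) ->
    \sum_i \sum_(m <- S) F i m = \sum_r F (c r).1 (c r).2.
  move=> F0; transitivity (\sum_(im <- s) F im.1 im.2); last by rewrite big_tnth.
  transitivity (\sum_(im <- [seq (i, m) | i <- enum 'I_q, m <- S]) F im.1 im.2).
    by rewrite big_allpairs /= big_enum.
  rewrite big_filter.
  rewrite [LHS](bigID (fun im => `[< U im.2 >] && (f im.2 == b im.1))) /=.
  rewrite [X in _ + X]big1 ?addr0 // => -[i m] /= nUf; apply: F0.
  have [Mm fm] := MG i m; apply: contrapT => Gm; move: nUf.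
  by have [//|Um] := MU _ _ Mm; rewrite (asboolT Um); case: fm => // ->; rewrite eqxx.
have genF : generates (fine_hom L) M (zero_mod p) (fun x => U x /\ (f x <= t + 0)%N) b' G'.
  split=> [r|r|x v Mv].
  - by have [Uc fc] := cs r; split=> //; rewrite fc; exact: bD.
  - by rewrite rowK; case: (MG (c r).1 (c r).2).
  have [w Hw wE] := GM _ _ (coarse_monom f HM Mv).
  pose a r : k := if ((c r).2 <= x)%MM then (w 0 (c r).1)@_(x - (c r).2) else 0.
  exists (\row_r a r).
    move=> r; rewrite mxE /a; case: ifP => [cx|_]; last by left.
    have [wr|wr] := boolP ((x - (c r).2)%MM \in msupp (w 0 (c r).1)); last first.
      by left; exact: memN_msupp_eq0.
    right; have [Lz _] := Hw _ _ wr; exists (x - (c r).2)%MM => //.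
    by rewrite addmC submK.
  rewrite /zero_mod /=; apply/eqP; rewrite subr_eq0; apply/eqP.
  have -> : v = coefs x (w *m G).
    by move/eqP: wE; rewrite subr_eq0 => /eqP <-; rewrite coefs_monom eqxx.
  apply/rowP => j; rewrite !mxE raddf_sum /=.
  under eq_bigr do rewrite (mcoeffM_uniq _ _ uS (GS _ j)).
  rewrite (sumE _ (fun i m => (if (m <= x)%MM then (w 0 i)@_(x - m) else 0) * (G i j)@_m)).
    by apply: eq_bigr => r _; rewrite !mxE.
  by move=> i m /rowP/(_ j); rewrite !mxE => ->; rewrite mulr0.
have Lb r : L (b' r) by apply: UL; case: (cs r).
exists (size s), b', G'; split=> //.
have HS : submod (fine_hom L) (syzygies (fine_hom L) b' G' (zero_mod p)).
  by apply: syzygies_submod => //; exact: zero_submod.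
have genF' : generates (fine_hom L) M (zero_mod p) (fun x => (f x <= t)%N) b' G'.
  by case: genF => bD' ? ?; split=> // r; case: (bD' r) => _; rewrite addn0.
unshelve epose proof (IHn t.+1 _ _ HS _ _) as SR.
- move=> x v [Fv _]; have [Ux|nUx] := pselect (U x); [by right|left].
  apply/rowP => r; rewrite mxE; case: (Fv r) => // bx.
  by case: nUx; apply: Uup bx _; case: (cs r).
- apply: coarse_syzygies => //.
  have genR := coarse_generates f_map HM Lb genF'.
  have genR' : generates (ring_hom L f) (coarse f M) (zero_mod p)
      (fun j => (j <= t + 0)%N) (fun i => f (b' i)) (monom_mx b' G').
    by case: genR => bR ? ?; split=> // r; rewrite addn0; exact: bR.
  have HC := coarse_submod f_map HM ML.
  have H0 := zero_submod (@ring_hom k d L f) p.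
  have Dmono l j : (j <= t + l)%N -> (j <= t + l.+1)%N by lia.
  have zeroC j (v : 'rV[{mpoly k[d]}]_p) : zero_mod p j v -> coarse f M j v.
    by move=> ->; exact: (submod0 HC).
  apply: resolves_mono (resolves_syzygies catR Dmono HC H0 zeroC genR' RR) => // l j.
  by rewrite addnS addSn.
apply: resolves_mono SR => // l x.
by rewrite addnS addSn.
Qed.

End Refining.

(** * From a linear resolution to the multigraded Koszul property *)

Section SemigroupRing.

Variables (k : fieldType) (d : nat) (L : set 'X_{1..d}) (f : 'X_{1..d} -> nat).
Hypotheses (L_sub : subsemigroup L) (f_grading : grading L f).

Let f_map : semigroup_map L f := f_grading.1.
Let f0 : f 0%MM = 0%N := map0 L_sub f_map.

Lemma semigroup_ring_subalgebra :
  subalgebra [set p : {mpoly k[d]} | forall m, m \in msupp p -> L m].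
Proof.
have [L0 LD] := L_sub.
split=> [|a p q|p q]; rewrite !inE /=.
- by move=> m; rewrite msupp1 inE => /eqP ->.
- move=> Lp Lq m /msuppD_le; rewrite mem_cat => /orP[/msuppZ_le|]; [exact: Lp|exact: Lq].
- by move=> Lp Lq m /msuppM_le /allpairsP[[u v] /= [/Lp Lu /Lq Lv ->]]; exact: LD.
Qed.

Lemma subalgebra_sum (A : set {mpoly k[d]}) (I : eqType) (r : seq I) (a : I -> k)
    (F : I -> {mpoly k[d]}) :
  subalgebra A -> (forall i, i \in r -> A (F i)) -> A (\sum_(i <- r) a i *: F i).
Proof.
move=> [A1 Alin _] AF; have A0 : A 0.
  have := Alin (-1) 1 1; rewrite !inE scaleN1r addNr; apply; exact: set_mem A1.
elim: r AF => [|i r IHr] AF; first by rewrite big_nil.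
rewrite big_cons; have := Alin (a i) (F i) (\sum_(i <- r) a i *: F i).
rewrite !inE; apply; first by apply: AF; rewrite mem_head.
by apply: IHr => j jr; apply: AF; rewrite in_cons jr orbT.
Qed.

Lemma semigroup_ringP (p : {mpoly k[d]}) :
  semigroup_ring k L p <-> (forall m, m \in msupp p -> L m).
Proof.
split=> [Ap|Lp A [HA LA]].
  apply: (Ap [set p | forall m, m \in msupp p -> L m]).
  split; first exact: semigroup_ring_subalgebra.
  by move=> _ [m Lm <-] x; rewrite msuppX inE => /eqP ->.
rewrite (mpolyE p); apply: subalgebra_sum => // m mp.
by apply: LA; exists m => //; exact: Lp.
Qed.

Lemma semigroup_ring_degP i (p : {mpoly k[d]}) :
  semigroup_ring_deg k L f i p <-> (forall m, m \in msupp p -> L m /\ f m = i).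
Proof.
rewrite /semigroup_ring_deg /=; split=> [[/semigroup_ringP Lp fp] m mp|Lp].
  by split; [exact: Lp|exact: fp].
by split=> [|m /Lp[]//]; apply/semigroup_ringP => m /Lp[].
Qed.

Lemma irrelevant_idealP (p : {mpoly k[d]}) :
  irrelevant_ideal (semigroup_ring_deg k L f) p <->
  (forall m, m \in msupp p -> L m /\ m <> 0%MM).
Proof.
have [_ fpos] := f_grading; split=> [[n [c [Hc ->]]] m|Lp].
  move=> /msupp_sum_le /flatten_mapP[i _]; have /semigroup_ring_degP Hi := Hc i.
  by move=> /Hi[Lm fm]; split=> // m0; move: fm; rewrite m0 f0.
exists (\max_(m <- msupp p) f m)%N, (fun i => mrestr (fun m => f m == i.+1) p); split.
  move=> i; apply/semigroup_ring_degP => m; rewrite mcoeff_msupp mcoeff_restr.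
  case: ifP => [/eqP fm|_]; last by rewrite eqxx.
  by rewrite -mcoeff_msupp => /Lp[].
apply/mpolyP => m; rewrite raddf_sum /=.
under eq_bigr do rewrite mcoeff_restr.
have [mp|/memN_msupp_eq0 ->] := boolP (m \in msupp p); last first.
  by rewrite big1 // => i _; case: ifP.
have [Lm m0] := Lp m mp; have fm0 := fpos _ Lm m0.
have fmn : (f m <= \max_(m <- msupp p) f m)%N by exact: leq_bigmax_seq.
have fm : ((f m).-1 < \max_(m <- msupp p) f m)%N by lia.
rewrite (bigD1 (Ordinal fm)) //= prednK // eqxx big1 ?addr0 // => i /eqP ni.
by case: eqP => // fmi; case: ni; apply: val_inj; rewrite /= fmi.
Qed.

Lemma mrestr_mul (P Q : pred 'X_{1..d}) (p q : {mpoly k[d]}) :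
  (forall m x, m \in msupp p -> x \in msupp q -> P (m + x)%MM = Q m) ->
  mrestr P (p * q) = mrestr Q p * q.
Proof.
move=> PQ; apply/mpolyP => x; rewrite mcoeff_restr.
rewrite !(mcoeffM_uniq _ _ (msupp_uniq q) (fun _ => id)).
transitivity (\sum_(m <- msupp q)
    (if P x then (if (m <= x)%MM then p@_(x - m) else 0) * q@_m else 0)).
  by case: (P x) => //; rewrite big1.
apply: eq_big_seq => m mq; case: (boolP (m <= x)%MM) => mx; last first.
  by rewrite mul0r; case: (P x).
rewrite mcoeff_restr; have [mp|/memN_msupp_eq0 ->] := boolP ((x - m)%MM \in msupp p).
  by rewrite -(PQ _ _ mp mq) submK //; case: (P x) => //; rewrite mul0r.
by case: (P x); case: (Q _); rewrite ?mul0r.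
Qed.

(** A matrix of linear forms is homogeneous, so a homogeneous vector in its image
    is the image of one homogeneous component of any preimage. *)
Lemma homogeneous_lift p q i j (D : 'M[{mpoly k[d]}]_(q, p)) (v : 'rV_p) (w : 'rV_q) :
  mx_over (semigroup_ring_deg k L f 1) D -> mx_over (semigroup_ring k L) w ->
  (forall t, ring_hom L f i j (v 0 t)) -> v = w *m D ->
  exists2 w' : 'rV_q, (forall s, ring_hom L f i.+1 j (w' 0 s)) & v = w' *m D.
Proof.
move=> HD Hw Hv vE.
have wL s m : m \in msupp (w 0 s) -> L m by have /semigroup_ringP := Hw 0 s; apply.
have DL s t m : m \in msupp (D s t) -> L m /\ f m = 1%N.
  by have /semigroup_ring_degP := HD s t; apply.
exists (\row_s mrestr (fun m => f m + i.+1 == j)%N (w 0 s)).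
  move=> s m; rewrite mxE mcoeff_msupp mcoeff_restr; case: ifP => [/eqP fm|_]; last by rewrite eqxx.
  by rewrite -mcoeff_msupp => /wL.
apply/rowP => t; rewrite mxE.
have -> : v 0 t = mrestr (fun m => f m + i == j)%N (v 0 t).
  apply/mpolyP => x; rewrite mcoeff_restr.
  have [/Hv[_ ->]|/memN_msupp_eq0 ->] := boolP (x \in msupp (v 0 t)); first by rewrite eqxx.
  by case: ifP.
have restr_sum (P : pred 'X_{1..d}) (F : 'I_q -> {mpoly k[d]}) :
    mrestr P (\sum_s F s) = \sum_s mrestr P (F s).
  apply/mpolyP => x; rewrite mcoeff_restr !raddf_sum /=.
  under [RHS]eq_bigr do rewrite mcoeff_restr.
  by case: (P x) => //; rewrite big1.
rewrite vE mxE restr_sum; apply: eq_bigr => s _; rewrite mxE.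
apply: mrestr_mul => m x /wL Lm /DL[Lx fx].
by rewrite f_map // fx addn1 addSnnS.
Qed.

Section FromLinearResolution.

Variables (b : nat -> nat) (D : forall i, 'M[{mpoly k[d]}]_(b i.+1, b i))
  (eps : 'cV[{mpoly k[d]}]_(b 0%N)).
Hypothesis D_res : linear_resolution (semigroup_ring k L) (semigroup_ring_deg k L f) D eps.

Let Hom := @ring_hom k d L f.
Let catR : linear_category Hom := ring_category k L_sub f_map.
Let M1 := @indicator k _ (fun x => L x /\ x <> 0%MM).
Let Aug := coarse f M1.

Let M1_sub : submod (fine_hom L) M1.
Proof. exact: nonzero_submod. Qed.

Let Aug_sub : submod Hom Aug.
Proof.
by apply: coarse_submod => // x v [|[Lx _]]; [left|right].
Qed.

Let AugP j (u : 'rV_1) : Aug j u <-> forall m, m \in msupp (u 0 0) -> [/\ L m, m <> 0%MM & f m = j].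
Proof.
have uE m : coefs m u = 0 <-> (u 0 0)@_m = 0.
  split=> [/rowP/(_ 0)|u0]; first by rewrite !mxE.
  by apply/rowP => i; rewrite ord1 !mxE.
split=> [Au m|Hu m].
  rewrite mcoeff_msupp => /eqP um; have [M1u fm] := Au m.
  by case: M1u fm => [/uE//|[? ?]] [/uE//|].
have [/Hu[? ? ?]|/memN_msupp_eq0/uE um] := boolP (m \in msupp (u 0 0)).
  by split; right.
by split; left.
Qed.

Let homP i j (p : {mpoly k[d]}) : semigroup_ring_deg k L f i p -> Hom j (i + j)%N p.
Proof. by move=> /semigroup_ring_degP Hp m /Hp[Lm ->]. Qed.

Let hom_ring i j p : Hom i j p -> semigroup_ring k L p.
Proof. by move=> Hp; apply/semigroup_ringP => m /Hp[]. Qed.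

Let D_lin := lr_linear D_res.

Let resolves_image_D n i :
  resolves Hom n (fun l j => (j <= i.+2 + l)%N)
    (syzygies Hom (fun=> i.+1) (D i) (zero_mod (b i))) (zero_mod (b i.+1)).
Proof.
elim: n i => [//|n IHn] i.
exists (b i.+2), (fun=> i.+2), (D i.+1); split; last first.
  by apply: resolves_mono (IHn i.+1) => // l j; rewrite addnS addSn.
split=> [_|s|j v [Fv v0]].
- by rewrite addn0.
- split=> [t|]; first by rewrite mxE; exact: (homP i.+1 (@D_lin i.+1 s t)).
  apply/(lr_exact D_res) => [p t|].
    by rewrite mxE; apply: hom_ring; exact: (homP 0 (@D_lin i.+1 s t)).
  exists (delta_mx 0 s); last by rewrite rowE.
  move=> p t; apply/semigroup_ringP => m; rewrite mxE.
  by case: (_ && _); rewrite ?msupp0 // msupp1 inE => /eqP ->; case: L_sub.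
have Av : mx_over (semigroup_ring k L) v by move=> p t; rewrite ord1; exact: hom_ring (Fv t).
have [w Aw vE] := (lr_exact D_res Av).1 v0.
have [w' Fw' vE'] := homogeneous_lift (@D_lin i.+1) Aw Fv vE.
by exists w' => //; rewrite -vE' /zero_mod /= subrr.
Qed.

Let resolves_kernel_eps n :
  resolves Hom n (fun l j => (j <= 1 + l)%N)
    (syzygies Hom (fun=> 0%N) eps Aug) (zero_mod (b 0%N)).
Proof.
case: n => [//|n].
exists (b 1%N), (fun=> 1%N), (D 0); split; last first.
  exact: resolves_mono (resolves_image_D n 0).
split=> [//|s|j v [Fv v0]].
- split=> [t|]; first by rewrite mxE; exact: (homP 0 (@D_lin 0 s t)).
  apply/AugP => m; rewrite mxE => /msupp_sum_le /flatten_mapP[t _].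
  rewrite mxE => /msuppM_le /allpairsP[[x y] /= [xD ye ->]].
  have /semigroup_ring_degP/(_ _ xD)[Lx fx] := @D_lin 0 s t.
  have /semigroup_ring_degP/(_ _ ye)[Ly fy] := lr_aug D_res t 0.
  have fxy : f (x + y)%MM = 1%N by rewrite f_map // fx fy.
  split=> //; first by case: L_sub => _; apply.
  by move=> xy0; move: fxy; rewrite xy0 f0.
have Av : mx_over (semigroup_ring k L) v by move=> p t; rewrite ord1; exact: hom_ring (Fv t).
have [|w Aw vE] := (lr_exact_aug D_res Av).1.
  by apply/irrelevant_idealP => m; move/AugP: v0 => v0 /v0[].
have [w' Fw' vE'] := homogeneous_lift (@D_lin 0) Aw Fv vE.
by exists w' => //; rewrite -vE' /zero_mod /= subrr.
Qed.

(** The resolution resolves k as the quotient of a free module by the kernel of the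
    augmentation.  This quotient is also A/A_+, generated by 1 with syzygies A_+;
    as the choice of generators is irrelevant, A_+ is resolved. *)
Lemma linear_resolution_fine_koszul : fine_koszul k L f.
Proof.
move=> n; have [L0 LD] := L_sub.
suff AR : resolves Hom n (fun l j => (j <= 1 + l)%N) Aug (zero_mod 1).
  pose U x := L x /\ x <> 0%MM.
  apply: resolves_mono (resolves_of_coarse (U := U) L_sub f_map _ _ M1_sub _ AR) => //.
  - by move=> l x [[? ?]].
  - by move=> x [].
  - exact: nonzero_up.
pose F := free_mod Hom (fun _ : 'I_(b 0%N) => 0%N).
pose F1 := free_mod Hom (fun _ : 'I_1 => 0%N).
pose Z := syzygies Hom (fun=> 0%N) eps Aug.
have HF : submod Hom F by exact: free_submod.
have HF1 : submod Hom F1 by exact: free_submod.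
have HZ : submod Hom Z by exact: syzygies_submod.
have H0 q := zero_submod Hom q.
have AF j v : Aug j v -> F1 j v.
  by move=> /AugP Av i m; rewrite ord1 => /Av[? _ <-]; rewrite addn0.
(* [Z] is the kernel of the map [F -> F1 / Aug] induced by [eps]. *)
have FZ : resolves Hom n.+1 (fun l j => (j <= l)%N) F Z.
  apply: (resolves_quot catR (L := zero_mod _)) => //.
  - by move=> j v ->; exact: (submod0 HZ).
  - by move=> j v [].
  - exact: resolves_free.
have eps_const t m : m \in msupp (eps t 0) -> L m /\ f m = 0%N.
  by have /semigroup_ring_degP := lr_aug D_res t 0; apply.
have L_eq0 m : L m -> f m = 0%N -> m = 0%MM.
  by move=> Lm fm; apply: contrapT => /(f_grading.2 _ Lm); rewrite fm.
have FA : resolves Hom n.+1 (fun l j => (j <= l)%N) F1 Aug.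
  apply: (resolves_image catR (M := F) (K := Z) (phi := eps)) => //.
  - move=> j v Fv i m; rewrite ord1 mxE => /msupp_sum_le /flatten_mapP[t _].
    move=> /msuppM_le /allpairsP[[x y] /= [/Fv[Lx fx] /eps_const[Ly fy] ->]].
    by split; [exact: LD|rewrite f_map // fy; lia].
  - move=> [|j] v Fv; last first.
      exists 0; first exact: (submod0 HF).
      rewrite mul0mx subr0; apply/AugP => m /Fv[Lm]; rewrite addn0 => fm.
      by split=> // m0; move: fm; rewrite m0 f0.
    have [v1 _ /irrelevant_idealP v1E] := lr_surjective D_res.
    have v10 : ((v1 *m eps) 0 0)@_0%MM = 1.
      have : ((v1 *m eps) 0 0 - 1)@_0%MM = 0.
        by apply: memN_msupp_eq0; apply/negP => /v1E[_].
      by rewrite mcoeffB mcoeff1 eqxx => /eqP; rewrite subr_eq0 => /eqP.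
    have const_eps t : eps t 0 = ((eps t 0)@_0%MM)%:MP.
      apply/mpolyP => m; rewrite mcoeffC; case: eqP => [->|m0]; first by rewrite mulr1.
      rewrite mulr0; apply: memN_msupp_eq0; apply/negP => /eps_const[Lm fm].
      by case: m0; exact: L_eq0.
    have const_v : v 0 0 = ((v 0 0)@_0%MM)%:MP.
      apply/mpolyP => m; rewrite mcoeffC; case: eqP => [->|m0]; first by rewrite mulr1.
      rewrite mulr0; apply: memN_msupp_eq0; apply/negP => /Fv[Lm]; rewrite addn0 => fm.
      by case: m0; exact: L_eq0.
    exists (\row_t ((v 0 0)@_0%MM * (v1 0 t)@_0%MM)%:MP).
      move=> t m; rewrite mxE msuppC; case: ifP => // _; rewrite inE => /eqP ->.
      by rewrite f0.
    have v1_eps : \sum_t (v1 0 t)@_0%MM * (eps t 0)@_0%MM = 1.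
      rewrite -[RHS]v10 mxE raddf_sum; apply: eq_bigr => t _ /=.
      by rewrite [in RHS]const_eps [in RHS]mulrC mcoeffCM mulrC.
    rewrite [X in Aug _ X](_ : _ = 0); first exact: (submod0 Aug_sub).
    apply/rowP => i; rewrite ord1 !mxE [X in X - _]const_v.
    under eq_bigr => t _ do rewrite mxE [X in _ * X]const_eps -mpolyCM -mulrA.
    by rewrite -raddf_sum -mulr_sumr v1_eps mulr1 subrr.
  - by move=> j v Fv; split=> [[]|].
have genA : generates Hom F1 Aug (fun j => (j <= 0)%N) (fun=> 0%N) (1%:M : 'M_1).
  split=> // [i m|j v Fv].
    rewrite !mxE !ord1 eqxx; exact: (lcat1 catR).
  exists v => //; rewrite mulmx1 subrr; exact: (submod0 Aug_sub).
apply: resolves_mono (resolves_syzygies catR _ HF1 Aug_sub AF genA FA) => //.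
  by move=> j v; rewrite /syzygies /= mulmx1; split=> [[]|Av] //; split=> //; exact: AF.
by move=> l j /leqW.
Qed.

End FromLinearResolution.

End SemigroupRing.

(** * From the multigraded Koszul property to a linear resolution *)

Section ToLinearResolution.

Variables (k : fieldType) (d : nat) (S : set 'X_{1..d}) (f : 'X_{1..d} -> nat).
Hypotheses (S_sub : subsemigroup S) (f_grading : grading S f).

Let f_map : semigroup_map S f := f_grading.1.
Let f0 : f 0%MM = 0%N := map0 S_sub f_map.
Let Hom := @fine_hom k d S.
Let catS : linear_category Hom := fine_category k S_sub.

Record linear_from t p (M : 'X_{1..d} -> set 'rV[k]_p) : Prop := LinearFrom {
  lf_sub : submod Hom M;
  lf_low : supported_on (fun x => S x /\ (t <= f x)%N) M;
  lf_res : forall n, resolves Hom n (fun l x => (f x <= t + l)%N) M (zero_mod p)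
}.

Let deg_eq t x := S x /\ f x = t.

Lemma generates_deg t p (M : 'X_{1..d} -> set 'rV[k]_p) : linear_from t M ->
  exists q (b : 'I_q -> _) (G : 'M_(q, p)), generates Hom M (zero_mod p) (deg_eq t) b G.
Proof.
move=> [HM Mlow /(_ 1%N)[q [b [G [[bD MG GM] _]]]]].
pose P := [pred i : 'I_q | row i G != 0].
exists #|P|, (fun i => b (enum_val i)), (rowsub (fun i : 'I_#|P| => enum_val i) G).
split=> [i|i|x m Mm].
- have := enum_valP i; rewrite inE => /eqP Gi.
  have := MG (enum_val i); case/Mlow => // -[Sb tb]; split=> //.
  by have := bD (enum_val i); lia.
- by rewrite row_rowsub.
have [v Fv vE] := GM _ _ Mm.
exists (colsub (fun i : 'I_#|P| => enum_val i) v); first by move=> i; rewrite mxE.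
move: vE; rewrite /zero_mod /= => <-; congr (m - _).
rewrite !mulmx_sum_row [RHS](bigID P) /= [X in _ = _ + X]big1 ?addr0; last first.
  by move=> i /negPn/eqP ->; rewrite scaler0.
transitivity (\sum_(i in P) v 0 i *: row i G); last by apply: eq_bigl.
by rewrite [RHS]big_enum_val; apply: eq_bigr => i _; rewrite mxE row_rowsub.
Qed.

(** In a relation among generators of one and the same degree, any of them with a
    nonzero coefficient is a scalar combination of the others, and these are
    available in every degree in which it is. *)
Lemma generates_drop D q p (M : 'X_{1..d} -> set 'rV[k]_p) (b : 'I_q.+1 -> _)
    (G : 'M_(q.+1, p)) (v : 'rV_q.+1) i0 :
  generates Hom M (zero_mod p) D b G -> v *m G = 0 -> v 0 i0 != 0 ->
  (forall i, v 0 i != 0 -> b i = b i0) ->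
  generates Hom M (zero_mod p) D (fun i => b (lift i0 i)) (row' i0 G).
Proof.
move=> [bD MG GM] v0 vi0 bv; split=> [//|i|y m Mm].
  by rewrite (_ : row i _ = row (lift i0 i) G) //; apply/rowP => j; rewrite !mxE.
have [u Fu uE] := GM _ _ Mm; pose c := u 0 i0 / v 0 i0.
exists (col' i0 (u - c *: v)).
  move=> j; rewrite !mxE; have [vj|vj] := eqVneq (v 0 (lift i0 j)) 0.
    by rewrite vj mulr0 subr0; exact: Fu.
  have [c0|c0] := eqVneq c 0; first by rewrite c0 mul0r subr0; exact: Fu.
  right; rewrite (bv _ vj); case: (Fu i0) => // ui0.
  by rewrite /c ui0 mul0r eqxx in c0.
move: uE; rewrite /zero_mod /= => <-; congr (m - _).
have -> : u *m G = (u - c *: v) *m G by rewrite mulmxBl -scalemxAl v0 scaler0 subr0.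
apply/rowP => j; rewrite !mxE (bigD1_ord i0) //= !mxE divfK // subrr mul0r add0r.
by apply: eq_bigr => i _; rewrite !mxE.
Qed.

(** With the least possible number of generators there is no relation in degree
    [t], so the syzygies start in degree [t + 1]. *)
Lemma linear_from_step t p (M : 'X_{1..d} -> set 'rV[k]_p) : linear_from t M ->
  exists q (b : 'I_q -> _) (G : 'M_(q, p)),
    generates Hom M (zero_mod p) (deg_eq t) b G /\
    linear_from t.+1 (syzygies Hom b G (zero_mod p)).
Proof.
have [S0 SD] := S_sub; have [_ fpos] := f_grading.
move=> HM; have [HMs _ Mres] := HM.
pose Q q := `[< exists (b : 'I_q -> _) (G : 'M_(q, p)),
  generates Hom M (zero_mod p) (deg_eq t) b G >].
have exQ : exists q, Q q.
  by have [q [b [G gG]]] := generates_deg HM; exists q; apply/asboolP; exists b, G.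
have [q /asboolP[b [G gG]] qmin] := ex_minnP exQ.
have [bD MG GM] := gG; exists q, b, G; split=> //.
have H0 := zero_submod Hom p.
split=> [|x v [Fv v0]|n]; first exact: syzygies_submod.
  have [->|] := eqVneq v 0; [by left|move=> /rV0Pn[i0 vi0]; right].
  have b_div i : v 0 i != 0 -> divides S (b i) x by case: (Fv i) => // ->; rewrite eqxx.
  have [z Sz xE] := b_div _ vi0; have [Sb fb] := bD i0.
  split; first by rewrite xE; exact: SD.
  have fxE : f x = (t + f z)%N by rewrite xE f_map // fb.
  rewrite fxE; have [z0|/(fpos _ Sz)] := pselect (z = 0%MM); last lia.
  have bx i : v 0 i != 0 -> b i = x.
    move=> /b_div[y Sy xy]; have [Sbi fbi] := bD i.
    have [y0|/(fpos _ Sy)] := pselect (y = 0%MM); first by rewrite xy y0 addm0.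
    by move: fxE; rewrite z0 f0 {1}xy f_map // fbi; lia.
  (* Otherwise all the generators involved have degree [x], and the number of
     generators was not minimal. *)
  exfalso; move: (q) (b) (G) (v) (i0) gG v0 vi0 bx qmin.
  case=> [|q'] b' G' v' i0' gG' v'0 vi0' bx' qmin; first by case: (i0').
  have /qmin : Q q'.
    apply/asboolP; exists (fun i => b' (lift i0' i)), (row' i0' G').
    by apply: (generates_drop gG' v'0 vi0') => i /bx' ->; rewrite bx'.
  by rewrite ltnn.
have gG' : generates Hom M (zero_mod p) (fun x => (f x <= t + 0)%N) b G.
  by split=> // i; have [_ ->] := bD i; rewrite addn0.
have Dmono l x : (f x <= t + l)%N -> (f x <= t + l.+1)%N by lia.
have zM x v : zero_mod p x v -> M x v by move=> ->; exact: (submod0 HMs).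
apply: resolves_mono (resolves_syzygies catS Dmono HMs H0 zM gG' (Mres n.+1)) => // l x.
by rewrite addnS addSn.
Qed.

(** The matrix over the polynomial ring of the multigraded map between free modules
    whose scalar matrix is [G]. *)
Definition step_mx q p (b : 'I_q -> 'X_{1..d}) (a : 'I_p -> 'X_{1..d}) (G : 'M[k]_(q, p)) :
    'M[{mpoly k[d]}]_(q, p) :=
  \matrix_(s, t) (G s t *: 'X_[b s - a t]).

Section Step.

Variables (t p q : nat) (a : 'I_p -> 'X_{1..d}) (M : 'X_{1..d} -> set 'rV[k]_p).
Variables (b : 'I_q -> 'X_{1..d}) (G : 'M[k]_(q, p)).
Hypotheses (a_deg : forall i, deg_eq t (a i)) (M_free : forall x v, M x v -> free_mod Hom a x v).
Hypotheses (M_sub : submod Hom M) (gen : generates Hom M (zero_mod p) (deg_eq t.+1) b G).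

Let G_div s i : G s i != 0 -> divides S (a i) (b s).
Proof.
move=> Gsi; have := M_free (gen_mem gen s) i; rewrite mxE.
by case=> // G0; rewrite G0 eqxx in Gsi.
Qed.

Lemma step_mx_linear : mx_over (semigroup_ring_deg k S f 1) (step_mx b a G).
Proof.
move=> s i; apply/(semigroup_ring_degP f S_sub) => m; rewrite mxE.
have [->|Gsi] := eqVneq (G s i) 0; first by rewrite scale0r msupp0.
rewrite msuppMCX // inE => /eqP ->.
have [Sz bE] := divides_subr (G_div Gsi); split=> //.
have [[Sa fa] [_ fb]] := (a_deg i, gen_deg gen s).
have : f (b s) = (f (a i) + f (b s - a i)%MM)%N by rewrite {1}bE f_map.
by lia.
Qed.

Lemma step_mx_shift : step_mx b a G *m shift_mx k a = monom_mx b G.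
Proof.
apply/row_matrixP => s; rewrite row_mul row_monom_mx; apply/rowP => i.
rewrite mul_shift_mx !mxE; have [->|Gsi] := eqVneq (G s i) 0.
  by rewrite !scale0r mul0r.
rewrite -scalerAl -mpolyXD; have [z _ ->] := G_div Gsi.
by rewrite [(a i + z)%MM]addmC addmK.
Qed.

Lemma shift_inj n (c : 'I_n -> 'X_{1..d}) (u v : 'rV[{mpoly k[d]}]_n) :
  u *m shift_mx k c = v *m shift_mx k c -> u = v.
Proof.
move=> uv; apply/rowP => i; apply/eqP; rewrite -subr_eq0 -(mulX_eq0 (c i)).
by rewrite mulrBl -!mul_shift_mx uv subrr.
Qed.

Lemma coefs_shift_free n (c : 'I_n -> 'X_{1..d}) (w : 'rV_n) x :
  mx_over (semigroup_ring k S) w -> free_mod Hom c x (coefs x (w *m shift_mx k c)).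
Proof.
move=> Aw i; rewrite mxE mul_shift_mx mcoeffMXE; case: ifP => [cx|]; last by left.
have [wx|/memN_msupp_eq0] := boolP ((x - c i)%MM \in msupp (w 0 i)); last by left.
right; exists (x - c i)%MM; last by rewrite addmC submK.
by have /(semigroup_ringP S_sub) := Aw 0 i; apply.
Qed.

(** In absolute multidegrees a product with the polynomial matrix is, coefficient
    by coefficient, a product with the scalar matrix; so its image is described
    by the multigraded module that the scalar matrix generates. *)
Lemma step_mx_image (v : 'rV_p) :
  (forall x, M x (coefs x (v *m shift_mx k a))) <->
  exists2 w, mx_over (semigroup_ring k S) w & v = w *m step_mx b a G.
Proof.
split=> [Mv|[w Aw ->] x].
  have [w vE wS] := span_monom_mx gen Mv; exists w.
    by move=> i j; rewrite ord1; apply/(semigroup_ringP S_sub) => m /wS[].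
  by apply: (@shift_inj _ a); rewrite -mulmxA step_mx_shift.
rewrite -mulmxA step_mx_shift coefs_monom_mx.
apply: (submod_comb M_sub (gen_mem gen)); exact: coefs_shift_free.
Qed.

Lemma step_mx_kernel (w : 'rV_q) : mx_over (semigroup_ring k S) w ->
  w *m step_mx b a G = 0 <->
  (forall x, syzygies Hom b G (zero_mod p) x (coefs x (w *m shift_mx k b))).
Proof.
move=> Aw; split=> [w0 x|Sw].
  split; first exact: coefs_shift_free.
  by rewrite /zero_mod /= -coefs_monom_mx -step_mx_shift mulmxA w0 mul0mx coefs0.
apply: (@shift_inj _ a); rewrite mul0mx -mulmxA step_mx_shift.
apply: coefsP => x; rewrite coefs_monom_mx coefs0.
by case: (Sw x).
Qed.

End Step.

(** The [i]-th syzygy module of a minimal multigraded resolution, inside the free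
    module on the generators of the previous step. *)
Record stage (i : nat) : Type := Stage {
  st_rank : nat;
  st_deg : 'I_st_rank -> 'X_{1..d};
  st_mod : 'X_{1..d} -> set 'rV[k]_st_rank;
  st_degP : forall s, deg_eq i (st_deg s);
  st_free : forall x v, st_mod x v -> free_mod Hom st_deg x v;
  st_linear : linear_from i.+1 st_mod
}.

Definition stage_step i (s : stage i) (s' : stage i.+1)
    (G : 'M[k]_(st_rank s', st_rank s)) : Prop :=
  generates Hom (@st_mod _ s) (zero_mod _) (deg_eq i.+1) (@st_deg _ s') G /\
  @st_mod _ s' = syzygies Hom (@st_deg _ s') G (zero_mod _).

Lemma stage_next i (s : stage i) : exists s' : {s' : stage i.+1 & 'M[k]_(st_rank s', st_rank s)},
  stage_step (projT2 s').
Proof.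
have [q [b [G [gG HG]]]] := linear_from_step (st_linear s).
have SF x v : syzygies Hom b G (zero_mod _) x v -> free_mod Hom b x v by case.
by exists (existT _ (Stage (gen_deg gG) SF HG) G).
Qed.

Definition next i (s : stage i) := projT1 (cid (stage_next s)).

Fixpoint stages (s0 : stage 0) i : stage i :=
  if i is j.+1 then projT1 (next (stages s0 j)) else s0.

Lemma resolves_linear_resolution :
  (forall n, resolves Hom n (fun l x => (f x <= 1 + l)%N)
    (indicator (fun x => S x /\ x <> 0%MM)) (zero_mod 1)) ->
  exists (b : nat -> nat) (D : forall i, 'M_(b i.+1, b i)) (eps : 'cV_(b 0%N)),
    linear_resolution (semigroup_ring k S) (semigroup_ring_deg k S f) D eps.
Proof.
have [S0 SD] := S_sub; have [_ fpos] := f_grading.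
move=> Sres; pose M := @indicator k _ (fun x => S x /\ x <> 0%MM).
have Mlin : linear_from 1 M.
  split=> //; first exact: nonzero_submod.
  by move=> x v [->|[Sx x0]]; [left|right; split=> //; exact: fpos].
have Mfree x v : M x v -> free_mod Hom (fun _ : 'I_1 => 0%MM) x v.
  by move=> [->|[Sx _]] i; [left; rewrite mxE|right; exists x => //; rewrite add0m].
have Mdeg (i : 'I_1) : deg_eq 0 0%MM by split.
pose st := stages (Stage Mdeg Mfree Mlin).
pose G i : 'M_(st_rank (st i.+1), st_rank (st i)) := projT2 (next (st i)).
have stP i : stage_step (G i) by exact: (projT2 (cid (stage_next (st i)))).
pose D i := step_mx (@st_deg _ (st i.+1)) (@st_deg _ (st i)) (G i).
have image i (v : 'rV_(st_rank (st i))) :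
    (forall x, st_mod x (coefs x (v *m shift_mx k (@st_deg _ (st i))))) <->
    exists2 w, mx_over (semigroup_ring k S) w & v = w *m D i.
  have [gG _] := stP i.
  exact: (step_mx_image (@st_free _ (st i)) (lf_sub (st_linear (st i))) gG v).
exists (fun i => st_rank (st i)), D, 1%:M; split.
- move=> i; have [gG _] := stP i.
  exact: (step_mx_linear (@st_degP _ (st i)) (@st_free _ (st i)) gG).
- move=> i j; apply/(semigroup_ring_degP f S_sub) => m; rewrite !mxE !ord1 eqxx.
  by rewrite msupp1 inE => /eqP ->.
- exists 1%:M.
    move=> i j; apply/(semigroup_ringP S_sub) => m; rewrite !mxE !ord1 eqxx.
    by rewrite msupp1 inE => /eqP ->.
  rewrite mul1mx mxE eqxx subrr; apply/(irrelevant_idealP S_sub f_grading) => m.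
  by rewrite msupp0.
- move=> v Av; rewrite mulmx1 -(image 0%N).
  rewrite (irrelevant_idealP S_sub f_grading).
  have vE : v *m shift_mx k (@st_deg _ (st 0%N)) = v.
    by apply/rowP => i; rewrite mul_shift_mx mpolyX0 mulr1.
  rewrite vE; split=> [Sv x|Mv m].
    have [xv|/memN_msupp_eq0 xv] := boolP (x \in msupp (v 0 0)).
      by right; exact: Sv.
    by left; apply/rowP => i; rewrite ord1 !mxE.
  rewrite mcoeff_msupp; have [/rowP/(_ 0)|//] := Mv m.
  by rewrite !mxE => ->; rewrite eqxx.
- move=> i v Av; rewrite -(image i.+1).
  have [gG ->] := stP i.
  exact: (step_mx_kernel (@st_free _ (st i)) gG Av).
Qed.

End ToLinearResolution.

(** * Semigroup rings generated in degree one *)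

Lemma subsemigroup_gen_sub d (G : set 'X_{1..d}) : subsemigroup (subsemigroup_gen G).
Proof.
split=> [T [[T0 _] _]|m1 m2 H1 H2 T HT] //.
by case: (HT) => -[_ TD] _; apply: TD; [exact: H1|exact: H2].
Qed.

(** For the weighted product, this form is easier to reach than a minimal generating
    set. *)
Definition degree_one_generated d (S : set 'X_{1..d}) (f : 'X_{1..d} -> nat) : Prop :=
  forall m, S m -> exists2 s : seq 'X_{1..d},
    (forall x, x \in s -> S x /\ f x = 1%N) & m = (\sum_(x <- s) x)%MM.

Lemma standard_grading_generated d (S G : set 'X_{1..d}) f :
  minimal_generating_set S G -> standard_grading S f -> degree_one_generated S f.
Proof.
move=> minG [f_map fG]; have SE := minG.1.
have S_sub : subsemigroup S by rewrite SE; exact: subsemigroup_gen_sub.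
have GS m : G m -> S m by move=> Gm; rewrite SE => T [_]; apply.
have [S0 SD] := S_sub.
move=> m; rewrite {1}SE => /(_ [set m | exists2 s : seq 'X_{1..d},
    (forall x, x \in s -> S x /\ f x = 1%N) & m = (\sum_(x <- s) x)%MM]).
apply; split; last first.
  move=> x Gx; exists [:: x]; last by rewrite big_seq1.
  by move=> y; rewrite inE => /eqP ->; split; [exact: GS|exact: (fG _ minG)].
split=> [|m1 m2 [s1 Hs1 ->] [s2 Hs2 ->]]; first by exists [::]; rewrite ?big_nil.
exists (s1 ++ s2); last by rewrite big_cat.
by move=> x; rewrite mem_cat => /orP[/Hs1|/Hs2].
Qed.

Section StandardGraded.

Variables (d : nat) (S : set 'X_{1..d}) (f : 'X_{1..d} -> nat).
Hypotheses (S_sub : subsemigroup S) (f_map : semigroup_map S f).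
Hypothesis S_gen : degree_one_generated S f.

Lemma semigroup_sum (s : seq 'X_{1..d}) : (forall x, x \in s -> S x) ->
  S (\sum_(x <- s) x)%MM /\ f (\sum_(x <- s) x)%MM = (\sum_(x <- s) f x)%N.
Proof.
have [S0 SD] := S_sub; elim: s => [|x s IHs] Ss.
  by rewrite !big_nil (map0 S_sub f_map).
have Sx : S x by apply: Ss; rewrite mem_head.
have [Ssum fsum] : S (\sum_(x <- s) x)%MM /\ f (\sum_(x <- s) x)%MM = (\sum_(x <- s) f x)%N.
  by apply: IHs => y ys; apply: Ss; rewrite in_cons ys orbT.
by rewrite !big_cons; split; [exact: SD|rewrite f_map // fsum].
Qed.

Lemma degree_one_sum (s : seq 'X_{1..d}) : (forall x, x \in s -> S x /\ f x = 1%N) ->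
  S (\sum_(x <- s) x)%MM /\ f (\sum_(x <- s) x)%MM = size s.
Proof.
move=> Hs; have [|Ss ->] := @semigroup_sum s; first by move=> x /Hs[].
split=> //; rewrite -sum1_size; apply: eq_big_seq => x /Hs[_ //].
Qed.

Lemma generated_grading : grading S f.
Proof.
split=> // m Sm m0; have [s Hs mE] := S_gen Sm.
rewrite mE; have [_ ->] := degree_one_sum Hs.
by case: s mE {Hs} => // mE; case: m0; rewrite mE big_nil.
Qed.

Variable k : fieldType.

Lemma semigroup_ring_standard_graded :
  standard_graded (semigroup_ring k S) (semigroup_ring_deg k S f).
Proof.
have [S0 SD] := S_sub; have [_ fpos] := generated_grading.
have f0 := map0 S_sub f_map.
have AE : semigroup_ring k S = [set p | forall m, m \in msupp p -> S m].
  by apply/seteqP; split=> p /(semigroup_ringP S_sub).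
have degP := semigroup_ring_degP f S_sub.
have subA : subalgebra (semigroup_ring k S) by rewrite AE; exact: semigroup_ring_subalgebra.
have restr_deg i p : semigroup_ring k S p ->
    semigroup_ring_deg k S f i (mrestr (fun m => f m == i) p).
  rewrite AE => Sp; apply/degP => m; rewrite mcoeff_msupp mcoeff_restr.
  case: ifP => [/eqP fm|_]; last by rewrite eqxx.
  by rewrite -mcoeff_msupp => /Sp.
split=> //.
- move=> i; split=> [|a p q]; rewrite !inE.
    by apply/degP => m; rewrite msupp0.
  move=> /degP Hp /degP Hq; apply/degP => m /msuppD_le.
  by rewrite mem_cat => /orP[/msuppZ_le/Hp|/Hq].
- by move=> i p [].
- move=> p Ap; exists (\max_(m <- msupp p) f m).+1, (fun i => mrestr (fun m => f m == i) p).
  split=> [i|]; first exact: restr_deg.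
  apply/mpolyP => m; rewrite raddf_sum /=; under eq_bigr do rewrite mcoeff_restr.
  have [mp|/memN_msupp_eq0 ->] := boolP (m \in msupp p); last first.
    by rewrite big1 // => i _; case: ifP.
  have fm : (f m < (\max_(m <- msupp p) f m).+1)%N by rewrite ltnS; exact: leq_bigmax_seq.
  rewrite (bigD1 (Ordinal fm)) //= eqxx big1 ?addr0 // => i /eqP ni.
  by case: eqP => // fmi; case: ni; apply: val_inj; rewrite /= fmi.
- move=> n c Hc c0 i ilt; apply/mpolyP => m; rewrite mcoeff0.
  apply/eqP; rewrite mcoeff_eq0; apply/negP => mi.
  have /degP/(_ m mi)[Sm fm] := Hc i.
  have := congr1 (mcoeff m) c0; rewrite raddf_sum /= (bigD1 (Ordinal ilt)) //= big1.
    by rewrite addr0 mcoeff0 => /eqP; rewrite mcoeff_eq0 mi.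
  move=> j /eqP ji; apply: memN_msupp_eq0; apply/negP => mj.
  have /degP/(_ m mj)[_ fmj] := Hc j.
  by case: ji; apply: val_inj; rewrite /= -fm -fmj.
- apply/seteqP; split=> [p /degP Hp|_ [c _ <-]].
    exists p@_0%MM => //; rewrite alg_mpolyC; apply/mpolyP => m; rewrite mcoeffC.
    have [->|m0] := eqVneq m 0%MM; first by rewrite mulr1.
    rewrite mulr0; apply/esym/memN_msupp_eq0/negP.
    by move=> /Hp[Sm fm]; have := fpos m Sm (elimN eqP m0); rewrite fm.
  apply/degP => m; rewrite alg_mpolyC msuppC; case: ifP => // _.
  by rewrite inE => /eqP ->.
- move=> i j p q /degP Hp /degP Hq; apply/degP => m /msuppM_le /allpairsP[[x y] /=].
  by move=> [/Hp[Sx <-] /Hq[Sy <-] ->]; split; [exact: SD|rewrite f_map].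
- apply/seteqP; split=> p; last by apply: smallest_sub => // q [].
  rewrite AE => Sp T [subT TA]; rewrite (mpolyE p).
  apply: subalgebra_sum => // m /Sp Sm; have [s Hs ->] := S_gen Sm.
  have [T1 _ TM] := subT.
  elim: s Hs => [_|x s IHs Hs].
    by rewrite big_nil mpolyX0; exact: set_mem T1.
  rewrite big_cons mpolyXD; apply: set_mem; apply: TM; apply: mem_set.
    apply: TA; apply/degP => y; rewrite msuppX inE => /eqP ->.
    by apply: Hs; rewrite mem_head.
  by apply: IHs => y ys; apply: Hs; rewrite in_cons ys orbT.
Qed.

End StandardGraded.

(** Write [gamma] as a sum of elements [x] of degree one and [lambda] as a sum of
    [g gamma] elements of degree one; then cut the second sum into blocks of lengths
    [g x]. *)
Lemma weighted_segre_generated d e (L : set 'X_{1..d}) (G : set 'X_{1..e}) f g h :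
  subsemigroup L -> subsemigroup G -> semigroup_map L f -> semigroup_map G g ->
  degree_one_generated L f -> degree_one_generated G h ->
  degree_one_generated (weighted_segre L f G g) (fun y => h (mnm_snd y)).
Proof.
move=> L_sub G_sub f_map g_map L_gen G_gen y [Ly Gy fgy].
have [l Hl lE] := L_gen _ Ly; have [c Hc cE] := G_gen _ Gy.
rewrite -[y]mnm_pairK lE cE.
have size_l : size l = (\sum_(x <- c) g x)%N.
  have [_ <-] := degree_one_sum L_sub f_map Hl.
  have [|_ <-] := @semigroup_sum _ _ _ G_sub g_map c; first by move=> x /Hc[].
  by rewrite -lE -cE.
elim: c l Hc Hl size_l {y Ly Gy fgy lE cE} => [|x c IHc] l Hc Hl.
  rewrite big_nil => /size0nil ->; exists [::] => //.
  by rewrite !big_nil; apply/mnmP => i; rewrite !mnmE; case: splitP => j _; rewrite mnmE.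
rewrite big_cons => size_l; pose l1 := take (g x) l.
have Hl1 z : z \in l1 -> L z /\ f z = 1%N by move/mem_take/Hl.
have Hl2 z : z \in drop (g x) l -> L z /\ f z = 1%N by move/mem_drop/Hl.
have [] := IHc (drop (g x) l) _ Hl2.
- by move=> z zc; apply: Hc; rewrite in_cons zc orbT.
- by rewrite size_drop size_l addKn.
move=> s Hs sE; have [Gx hx] := Hc x (mem_head _ _).
exists (mnm_pair (\sum_(z <- l1) z)%MM x :: s).
  move=> z; rewrite inE => /predU1P[->|/Hs//]; rewrite mnm_snd_pair; split=> //.
  have [Ll1 fl1] := degree_one_sum L_sub f_map Hl1.
  split; rewrite ?mnm_fst_pair ?mnm_snd_pair // fl1 size_take size_l.
  by case: ltnP => // ?; apply/eqP; rewrite eqn_leq leq_addr andbT.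
rewrite !big_cons -sE -{1}(cat_take_drop (g x) l) big_cat /=.
by apply/mnmP => i; rewrite !mnmE; case: splitP => j _; rewrite mnmDE.
Qed.

Theorem corollary3 (R : realType) (k : fieldType) (d e : nat)
    (Lambda : set 'X_{1..d}) (Gamma : set 'X_{1..e})
    (Lambda_affine : affine_semigroup Lambda)
    (Gamma_affine : affine_semigroup Gamma)
    (Lambda_spanning : spanning R Lambda)
    (Gamma_spanning : spanning R Gamma)
    (Lambda_homogeneous : homogeneous R Lambda)
    (Gamma_homogeneous : homogeneous R Gamma)
    (f : 'X_{1..d} -> nat) (f_standard : standard_grading Lambda f)
    (h : 'X_{1..e} -> nat) (h_standard : standard_grading Gamma h)
    (Lambda_koszul :
      koszul (semigroup_ring k Lambda) (semigroup_ring_deg k Lambda f))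
    (Gamma_koszul :
      koszul (semigroup_ring k Gamma) (semigroup_ring_deg k Gamma h))
    (g : 'X_{1..e} -> nat) (g_grading : grading Gamma g) :
  koszul (semigroup_ring k (weighted_segre Lambda f Gamma g))
    (semigroup_ring_deg k (weighted_segre Lambda f Gamma g)
       (fun m => h (mnm_snd m))).
Proof.
have [L_min L_minP _] := Lambda_homogeneous.
have [G_min G_minP _] := Gamma_homogeneous.
have L_sub : subsemigroup Lambda by rewrite L_minP.1; exact: subsemigroup_gen_sub.
have G_sub : subsemigroup Gamma by rewrite G_minP.1; exact: subsemigroup_gen_sub.
have L_gen := standard_grading_generated L_minP f_standard.
have G_gen := standard_grading_generated G_minP h_standard.
have f_grading := generated_grading L_sub f_standard.1 L_gen.
have h_grading := generated_grading G_sub h_standard.1 G_gen.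
have [_ [bL [DL [epsL resL]]]] := Lambda_koszul.
have [_ [bG [DG [epsG resG]]]] := Gamma_koszul.
have L_fine := linear_resolution_fine_koszul L_sub f_grading resL.
have G_fine := linear_resolution_fine_koszul G_sub h_grading resG.
have C_sub := weighted_segre_subsemigroup L_sub G_sub f_grading g_grading.
have C_gen := weighted_segre_generated L_sub G_sub f_grading.1 g_grading.1 L_gen G_gen.
have hC_map : semigroup_map (weighted_segre Lambda f Gamma g) (fun y => h (mnm_snd y)).
  by move=> x y [_ Gx _] [_ Gy _]; rewrite mnm_sndD h_grading.1.
split; first exact: semigroup_ring_standard_graded.
apply: resolves_linear_resolution => //; first exact: generated_grading.
exact: resolves_weighted_segre f_grading g_grading h_grading.1 L_fine G_fine.
Qed.
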